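(* Let $K$ be a totally real number field with ring of integers $\mathcal O$, let $\mathcal O^+$ be the set of totally positive elements of $\mathcal O$, and let $\mathcal P\subset\mathcal O^+$ be the set of primitive elements. Suppose $\mathfrak p$ is a prime ideal of $\mathcal O$ such that $5\in\mathfrak p$ and $\mathcal O/\mathfrak p\cong\mathbb Z/5\mathbb Z$. Let $X=\{\gamma\in\mathcal P\mid\gamma\equiv1,4\ (\mathrm{mod}\ \mathfrak p)\}$ and $Y=\{\gamma\in\mathcal P\mid\gamma\equiv2,3\ (\mathrm{mod}\ \mathfrak p)\}$. Then, as formal power $q$-sums with exponents in $\mathcal O^+\cup\{0\}$, \begin{align*} \prod_{\substack{\delta\in\mathcal O^+\\\delta\equiv1,4\ (\mathrm{mod}\ \mathfrak p)}}\frac1{1-q^{\delta}}=&\prod_{\gamma\in X}\left(\prod_{n=0}^{\infty}\frac1{(1-q^{(5n+1)\gamma})(1-q^{(5n+4)\gamma})}\right)\times\prod_{\gamma\in Y}\left(\prod_{n=0}^{\infty}\frac1{(1-q^{(5n+2)\gamma})(1-q^{(5n+3)\gamma})}\right)\\ =&\prod_{\gamma\in X}\left(\sum_{n=0}^{\infty}\frac{q^{n^2\gamma}}{(q^{\gamma})_n}\right)\prod_{\gamma\in Y}\left(\sum_{n=0}^{\infty}\frac{q^{n(n+1)\gamma}}{(q^{\gamma})_n}\right) \end{align*} and \begin{align*} \prod_{\substack{\delta\in\mathcal O^+\\\delta\equiv2,3\ (\mathrm{mod}\ \mathfrak p)}}\frac1{1-q^{\delta}}=&\prod_{\gamma\in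 X}\left(\prod_{n=0}^{\infty}\frac1{(1-q^{(5n+2)\gamma})(1-q^{(5n+3)\gamma})}\right)\times\prod_{\gamma\in Y}\left(\prod_{n=0}^{\infty}\frac1{(1-q^{(5n+1)\gamma})(1-q^{(5n+4)\gamma})}\right)\\ =&\prod_{\gamma\in X}\left(\sum_{n=0}^{\infty}\frac{q^{n(n+1)\gamma}}{(q^{\gamma})_n}\right)\prod_{\gamma\in Y}\left(\sum_{n=0}^{\infty}\frac{q^{n^2\gamma}}{(q^{\gamma})_n}\right). \end{align*}
   Context: An element $\gamma\in\mathcal O^+$ is primitive if $\gamma\notin n\mathcal O^+$ for every rational integer $n\ge 2$. The notation $\delta\equiv a,b\ (\mathrm{mod}\ \mathfrak p)$ means $\delta-a\in\mathfrak p$ or $\delta-b\in\mathfrak p$. Formal power $q$-sums: with $H=\mathcal O^+\cup\{0\}$ (a monoid under addition), $\mathbb R[[q]]_H$ is the ring of formal expressions $\sum_{\delta\in H}c_\delta q^\delta$, $c_\delta\in\mathbb R$, with coefficientwise addition and product $(\sum c_\delta q^\delta)(\sum d_\delta q^\delta)=\sum_{\gamma}\left(\sum_{\alpha+\beta=\gamma}c_\alpha d_\beta\right)q^\gamma$; this is well defined because each $\gamma\in H$ has finitely many decompositions $\gamma=\alpha+\beta$ with $\alpha,\beta\in H$. Infinite sums are taken coefficientwise. For $\delta\in\mathcal O^+$, $\frac1{1-q^\delta}$ means $1+q^\delta+q^{2\delta}+\cdots$. For a family $f_j=\sum_\delta a_{j,\delta}q^\delta$ ($j\in J$) with all $a_{j,0}=1$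 and, for each nonzero $\delta\in H$, only finitely many $j$ with $a_{j,\delta}\ne0$, the product $\prod_{j\in J}f_j$ is $\sum_\delta c_\delta q^\delta$, where $c_\delta$ is the sum of $a_{j_1,\delta_1}\cdots a_{j_r,\delta_r}$ over all finite sets of pairs $\{(j_1,\delta_1),\ldots,(j_r,\delta_r)\}$ with $j_1,\dots,j_r\in J$ pairwise distinct, $\delta_1,\ldots,\delta_r\in\mathcal O^+$ and $\delta_1+\cdots+\delta_r=\delta$ (so $c_0=1$). For $\gamma\in\mathcal O^+$, $(q^\gamma)_n=\prod_{j=1}^n(1-q^{j\gamma})$, with $(q^\gamma)_0=1$. *)

(* Defs.v *)
From HB Require Import structures.
From mathcomp Require Import all_boot all_order all_algebra all_field finmap.
From mathcomp Require Import ring_quotient complex.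
From mathcomp Require Import all_classical reals.

Set Implicit Arguments.
Unset Strict Implicit.
Unset Printing Implicit Defensive.

Import Order.TTheory GRing.Theory Num.Theory.
Local Open Scope classical_set_scope.
Local Open Scope ring_scope.

Section RingOfIntegers.
Variable K : fieldExtType rat.

Definition algint : {pred K} := fun x => `[< integralOver (intr : int -> K) x >].

Fact algint_subring_closed : subring_closed algint.
Proof.
split=> [|x y /asboolP hx /asboolP hy|x y /asboolP hx /asboolP hy]; apply/asboolP.
- exact: integral1.
- exact: integral_sub.
- exact: integral_mul.
Qed.

HB.instance Definition _ := GRing.isSubringClosed.Build K algint algint_subring_closed.

Record ring_of_integers := RingOfIntegers {
  integer_val :> K;
  _ : integer_val \in algint }.

HB.instance Definition _ := [isSub for integer_val].
HB.instance Definition _ := [Choice of ring_of_integers by <:].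
HB.instance Definition _ := [SubChoice_isSubComNzRing of ring_of_integers by <:].

End RingOfIntegers.

Section TotallyPositive.
Variables (R : realType) (K : fieldExtType rat).
Local Notation O := (ring_of_integers K).

Definition totally_real : Prop :=
  forall (s : {rmorphism K -> R[i]}) (x : K), complex.Im (s x) = 0.

Definition totpos : set O :=
  [set x | forall s : {rmorphism K -> R}, 0 < s (x : K)].

Definition primitive : set O :=
  [set x | totpos x /\
    forall n : nat, (2 <= n)%N -> ~ exists2 y : O, totpos y & x = y *+ n].

Definition totpos0 : {pred O} := fun x => `[< x = 0 \/ totpos x >].

Fact totpos0_addr_closed : addr_closed totpos0.
Proof.
split=> [|x y /asboolP [->|hx] /asboolP hy]; apply/asboolP; first by left.
- by rewrite add0r.
- case: hy => [->|hy]; first by rewrite addr0; right.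
  by right=> s; rewrite /= rmorphD addr_gt0.
Qed.

HB.instance Definition _ := GRing.isAddClosed.Build O totpos0 totpos0_addr_closed.

(* The monoid $H = \mathcal O^+ \cup \{0\}$ of exponents. *)
Record exponent := Exponent {
  exponent_val :> O;
  _ : exponent_val \in totpos0 }.

HB.instance Definition _ := [isSub for exponent_val].
HB.instance Definition _ := [Choice of exponent by <:].
HB.instance Definition _ :=
  GRing.SubChoice_isSubNmodule.Build O totpos0 exponent totpos0_addr_closed.

End TotallyPositive.

(* [\sum_(i \in A) F i] is the sum over the [i] in [A] with [F i != 0] when
   these are finitely many, and [0] otherwise.  The convention for infinite
   supports plays no role for [H = exponent R K] with [K] totally real: there,
   each [d : H] has finitely many decompositions [d = a + b]. *)
Section PowerSums.
Variables (R : comNzRingType) (H : nmodType).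

Definition qsum := H -> R.

Definition qexp (a : H) : qsum := fun d => (d == a)%:R.
Definition qone : qsum := qexp 0.
Definition qsub (f g : qsum) : qsum := fun d => f d - g d.

Definition qmul (f g : qsum) : qsum := fun d =>
  \sum_(x \in [set x : H * H | x.1 + x.2 = d]) f x.1 * g x.2.

(* Multiplicative inverse; the zero sum if there is none. *)
Definition qinv (f : qsum) : qsum :=
  xget (fun=> 0) [set g : qsum | qmul f g = qone].

Definition qseries (f : nat -> qsum) : qsum := fun d =>
  \sum_(n \in [set: nat]) f n d.

(* $1/(1 - q^a) = 1 + q^a + q^{2a} + \cdots$ *)
Definition qgeom (a : H) : qsum := qseries (fun n => qexp (a *+ n)).

(* $\prod_{j \in D} f_j$, for a family of sums with constant coefficient [1]
   such that each nonzero [d] is in the support of finitely many [f j].  In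
   [exponent R K], [x.2 != 0] says that [x.2] is totally positive. *)
Definition qprod (J : choiceType) (D : set J) (f : J -> qsum) : qsum := fun d =>
  \sum_(s \in [set s : {fset J * H} |
      [/\ forall x, x \in s -> D x.1 /\ x.2 != 0,
          {in s &, injective fst} &
          \sum_(x <- s) x.2 = d]])
    \prod_(x <- s) f x.1 x.2.

(* $(q^a)_n$ *)
Definition qpoch (a : H) (n : nat) : qsum :=
  \big[qmul/qone]_(1 <= j < n.+1) qsub qone (qexp (a *+ j)).

(* $\sum_{n \ge 0} q^{n^2 a} / (q^a)_n$ *)
Definition RR1_sum (a : H) : qsum :=
  qseries (fun n => qmul (qexp (a *+ (n ^ 2))) (qinv (qpoch a n))).

(* $\sum_{n \ge 0} q^{n (n + 1) a} / (q^a)_n$ *)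
Definition RR2_sum (a : H) : qsum :=
  qseries (fun n => qmul (qexp (a *+ (n * n.+1))) (qinv (qpoch a n))).

(* $\prod_{n \ge 0} 1 / ((1 - q^{(5n+i) a}) (1 - q^{(5n+j) a}))$ *)
Definition RR_prod (i j : nat) (a : H) : qsum :=
  qprod [set: nat] (fun n => qinv (qmul (qsub qone (qexp (a *+ (5 * n + i))))
                                        (qsub qone (qexp (a *+ (5 * n + j)))))).

End PowerSums.

(* $x \equiv a, b \pmod{\mathfrak p}$ *)
Definition eqmod_or (A : nzRingType) (p : {pred A}) (a b : nat) (x : A) : Prop :=
  x - a%:R \in p \/ x - b%:R \in p.

(* Main.v *)
(** The condition on p gives a ring morphism from the integers onto Z/5.  Every
    nonzero exponent is n * g for a unique primitive g and a unique n > 0, and its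
    class is n times that of g; sorting the factors of the left-hand products by
    their primitive part gives the first equality of each line.  All q-sums are compared
    below a fixed exponent d: since d has finitely many decompositions, every
    infinite product is there a finite product in a commutative ring.

    Decompositions are finitely many because an algebraic integer whose conjugates
    are bounded is a root of one of finitely many monic integer polynomials; the
    conjugates are the diagonal entries of the simultaneously triangularised
    regular representation.

    The Rogers-Ramanujan identities come from the unit Bailey pair: two steps of
    the Bailey chain express the sum side as a theta series, and the finite
    Jacobi triple product, that is the q-binomial theorem in base q^5, turns that series
    into a product. *)

Require Import Defs.
From HB Require Import structures.
From mathcomp Require Import all_boot all_order all_algebra all_field finmap.
From mathcomp Require Import ring_quotient complex polyrcf.
From mathcomp Require Import all_classical reals.
From mathcomp Require Import zify ring.

Set Implicit Arguments.
Unset Strict Implicit.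
Unset Printing Implicit Defensive.

Import Order.TTheory GRing.Theory Num.Theory.
Local Open Scope classical_set_scope.
Local Open Scope ring_scope.

(** * Gaussian binomials *)

(** The Bailey argument divides by factors $1-q^m$, so it is run in the fraction field of $\mathbb
    Z[X]$. Clearing denominators leaves an identity in $\mathbb Z[X]$, which specialises to $X=q^a$
    in the ring of q-sums. No limit is taken: the identities hold up to multiples of $q^{n+1}$, and
    such an error is invisible below [d] as soon as $(n+1)a$ is not a summand of [d]. The base $q^5$
    arises as follows. The unit Bailey pair has exponents with leading term $r^2/2$, and two steps
    of the chain add $2r^2$; the sum $5r^2/2$ is the growth of the exponents in the binomial theorem
    in base $q^5$. One theta series is thus evaluated in base $q$ and in base $q^5$. The parameter
    [e] treats both identities together: $e=0$ belongs to the classes 1, 4 and $e=1$ to the classes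
    2, 3. *)

Section GaussianBinomials.
Variables (A : comNzRingType) (q : A).

(* $\prod_{a < k \le b} (1 - q^k)$ *)
Definition poch (a b : nat) : A := \prod_(a <= k < b) (1 - q ^+ k.+1).

Lemma poch_cat a b c : (a <= b <= c)%N -> poch a b * poch b c = poch a c.
Proof. by move=> /andP[ab bc]; rewrite /poch [RHS](@big_cat_nat _ _ _ b). Qed.

Lemma pochnn a : poch a a = 1.
Proof. by rewrite /poch big_geq. Qed.

Lemma pochSr a b : (a <= b)%N -> poch a b.+1 = poch a b * (1 - q ^+ b.+1).
Proof. by move=> ab; rewrite /poch big_nat_recr. Qed.

Lemma pochSl a b : (a < b)%N -> poch a b = (1 - q ^+ a.+1) * poch a.+1 b.
Proof. by move=> ab; rewrite /poch big_ltn. Qed.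

Fixpoint gbin (n k : nat) : A :=
  match n, k with
  | _, 0%N => 1
  | 0%N, _.+1 => 0
  | n'.+1, k'.+1 => gbin n' k' + q ^+ k'.+1 * gbin n' k'.+1
  end.

Lemma gbin0 n : gbin n 0 = 1. Proof. by case: n. Qed.

Lemma gbin_small n k : (n < k)%N -> gbin n k = 0.
Proof.
elim: n k => [|n IHn] [|k] //=; rewrite ltnS => nk.
by rewrite !IHn ?mulr0 ?addr0 // ltnW.
Qed.

(** The factorial formula, free of denominators so that it makes sense in every commutative ring.
    Induction on [a + b] serves both terms of the Pascal rule. *)
Lemma gbin_poch a b :
  gbin (a + b) a * (poch 0 a * poch 0 b) = poch 0 (a + b).
Proof.
have [n abn] : exists n, n = (a + b)%N by exists (a + b)%N.
elim: n a b abn => [|n IHn] a b abn.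
  have -> : a = 0%N by lia.
  have -> : b = 0%N by lia.
  by rewrite gbin0 !pochnn !mul1r.
case: a abn => [|a] abn; first by rewrite gbin0 pochnn !mul1r.
rewrite addSn /= pochSr // [RHS]pochSr //.
have e1 := IHn a b (ltac:(lia)).
case: b abn e1 => [|b] abn e1.
  rewrite addn0 in e1 *; rewrite (gbin_small (ltnSn a)) mulr0 addr0 -[X in _ = X * _]e1.
  by rewrite pochnn; ring.
have e2 := IHn a.+1 b (ltac:(lia)).
rewrite addSnnS in e2.
rewrite (pochSr (leq0n a)) in e2.
rewrite (pochSr (leq0n b)) in e1 *.
(* Both summands are multiples of [poch 0 (a + b.+1)], and
   $1-q^{a+b+2}=(1-q^{a+1})+q^{a+1}(1-q^{b+1})$. *)
transitivity (gbin (a + b.+1) a * (poch 0 a * (poch 0 b * (1 - q ^+ b.+1))) *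
   (1 - q ^+ a.+1) + q ^+ a.+1 * (1 - q ^+ b.+1) *
   (gbin (a + b.+1) a.+1 * (poch 0 a * (1 - q ^+ a.+1) * poch 0 b))).
  by ring.
rewrite e1 e2; have -> : (a + b.+1).+1 = (a.+1 + b.+1)%N by lia.
  rewrite exprD; ring.
Qed.

(** Homogeneous in [x] and [y], so that a positive power of $q$ put into [y] can replace a negative
    one in [x]. The induction takes off the factor $y-x$ and replaces $x$ by $xq$. *)
Lemma gauss_binomial_theorem M (x y : A) :
  \sum_(i < M.+1) (-1) ^+ i * q ^+ 'C(i, 2) * x ^+ i * y ^+ (M - i) * gbin M i =
  \prod_(k < M) (y - x * q ^+ k).
Proof.
elim: M x => [|M IHM] x.
  by rewrite big_ord_recl !big_ord0 /= !expr0 !mul1r addr0.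
rewrite big_ord_recl expr0 mulr1.
have -> : \prod_(i < M) (y - x * q ^+ lift ord0 i) =
          \prod_(i < M) (y - (x * q) * q ^+ i).
  by apply: eq_bigr => i _; rewrite -mulrA -exprS.
rewrite -IHM mulrBl big_ord_recl /= !expr0 !mul1r subn0.
rewrite mulr_sumr [X in _ = X - _]big_ord_recl /= !expr0 !mul1r subn0 gbin0 !mulr1.
rewrite -exprS -addrA; congr (_ + _).
rewrite mulr_sumr.
rewrite (eq_bigr (fun i : 'I_M.+1 =>
   (-1) ^+ i.+1 * q ^+ 'C(i.+1, 2) * x ^+ i.+1 * y ^+ (M - i) *
     (q ^+ i.+1 * gbin M i.+1) +
   (-1) ^+ i.+1 * q ^+ 'C(i.+1, 2) * x ^+ i.+1 * y ^+ (M - i) * gbin M i)); last first.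
  by move=> i _; rewrite /bump /= add1n subSS; ring.
rewrite big_split /= -sumrN; congr (_ + _).
  rewrite big_ord_recr /= gbin_small // !mulr0 addr0.
  apply: eq_bigr => i _; rewrite /bump /= add1n exprMn.
  have -> : (M - i)%N = (M - i.+1).+1 by have := ltn_ord i; lia.
  by rewrite (exprS y); ring.
apply: eq_bigr => i _; rewrite binS bin1 exprMn exprD !exprS; ring.
Qed.

(** The limit $m\to\infty$ of the q-Vandermonde sum $\sum_k q^{k(k+a)}\binom nk\binom
    m{k+a}=\binom{n+m}{n+a}$, times $(q)_{n+a}$. The induction identifies the sum for $(n+1,a)$ with
    the one for $(n,a+1)$. *)
Lemma gauss_vandermonde n a :
  \sum_(k < n.+1) q ^+ (k * (k + a)) * gbin n k * poch (k + a) (n + a) = 1.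
Proof.
elim: n a => [|n IHn] a.
  by rewrite big_ord_recl big_ord0 /= mul0n expr0 pochnn !mul1r addr0.
rewrite -(IHn a.+1) big_ord_recl /= mul0n expr0 mul1r mul1r add0n.
rewrite (eq_bigr (fun i : 'I_n.+1 =>
   q ^+ (i * (i + a.+1)) * gbin n i * poch (i + a.+1) (n + a.+1) * q ^+ (i + a.+1) +
   q ^+ (i.+1 * (i.+1 + a)) * (q ^+ i.+1 * gbin n i.+1) * poch (i.+1 + a) (n.+1 + a))); last first.
  move=> i _; rewrite /bump /= add1n mulrDr mulrDl !addnS !addSn; congr (_ + _).
  have -> : (i.+1 * (i + a).+1 = i * (i + a).+1 + (i + a).+1)%N by lia.
  by rewrite exprD; ring.
rewrite big_split /= addrCA [X in _ + (_ + X)]big_ord_recr /= gbin_small // mulr0 mulr0 mul0r addr0.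
rewrite (_ : _ + \sum_(i < n) _ =
  \sum_(i < n.+1) q ^+ (i * (i + a)) * (q ^+ i * gbin n i) * poch (i + a) (n.+1 + a)); last first.
  by rewrite big_ord_recl /= mul0n expr0 gbin0 !mul1r.
(* The longer product has the extra factor $1-q^{i+a+1}$, the other summand the factor $q^{i+a+1}$;
   together they give 1. *)
rewrite -big_split; apply: eq_bigr => i _ /=.
rewrite (@pochSl (i + a)); last by have := ltn_ord i; lia.
rewrite !addnS !addSn.
have -> : (i * (i + a).+1 = i * (i + a) + i)%N by lia.
by rewrite exprD; ring.
Qed.

End GaussianBinomials.

(** * The Bailey chain *)

Lemma sum_ord_shift (V : nmodType) (G : nat -> V) r N : (r <= N)%N ->
  \sum_(s < N.+1 | (r < s.+1)%N) G s = \sum_(k < (N - r).+1) G (k + r)%N.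
Proof.
move=> rN; transitivity (\sum_(r <= s < N.+1) G s); first by rewrite big_geq_mkord.
by rewrite -{1}[r]add0n big_addn big_mkord subSn.
Qed.

(* Pairs the positions exchanged by the symmetry [i -> 2 n + e - i] of binomials; for [e = 0]
   the middle position is its own partner and is counted once. *)
Lemma sum_fold (V : nmodType) (G : nat -> V) n e : (e <= 1)%N ->
  \sum_(i < (2 * n + e).+1) G i =
  \sum_(r < n.+1) (G (n + r + e)%N *+ (r + e != 0)%N + G (n - r)%N).
Proof.
move=> e1; rewrite big_split /= -(big_mkord xpredT G).
rewrite (@big_cat_nat _ _ _ n.+1) /=; [|lia|lia].
rewrite addrC; congr (_ + _); last first.
  rewrite big_mkord (reindex_inj rev_ord_inj) /=; apply: eq_bigr => i _.
  by rewrite subSS.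
rewrite -{1}[n.+1]add0n big_addn.
case: e e1 => [|[|e]] // _.
  rewrite big_ord_recl /= mulr0n add0r.
  have -> : ((2 * n + 0).+1 - n.+1 = n)%N by lia.
  rewrite big_mkord; apply: eq_bigr => i _.
  by rewrite /bump /= !addn0 ?mulr1n; congr (G _); lia.
have -> : ((2 * n + 1).+1 - n.+1 = n.+1)%N by lia.
rewrite big_mkord; apply: eq_bigr => i _.
by rewrite !addn1 ?mulr1n; congr (G _); lia.
Qed.

(** The unit Bailey pair at $a=q^e$: for $e=0$ it is 1 followed by $(-1)^r q^{r(r-1)/2}(1+q^r)$, for
    $e=1$ it is $(-1)^r q^{r(r-1)/2}(1-q^{2r+1})$, with $1-q$ cleared. The indicator prevents the
    two terms that coincide at $r=e=0$ from being counted twice. *)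
Definition unit_alpha (A : comNzRingType) (e : nat) (q : A) (r : nat) : A :=
  (-1) ^+ r * ((r + e != 0)%N%:R * q ^+ 'C(r, 2) + (-1) ^+ e * q ^+ 'C((r + e).+1, 2)).

(** Each Bailey step contributes $q^{r(r+e)}$. The exponents become $(5r^2\pm r)/2$ for $e=0$, and
    $(5r^2+3r)/2$ and $(5(r+1)^2-3(r+1))/2$ for $e=1$. *)
Definition theta_term (A : comNzRingType) (e : nat) (q : A) (r : nat) : A :=
  q ^+ (2 * (r * (r + e))) * unit_alpha e q r.

Section BaileyChain.
Variables (F : fieldType) (e : nat).

Definition regular_base (q : F) := forall n, q ^+ n.+1 != 1.

(* Bailey pairs relative to $a = q^e$; for [e = 1] the factor $1 - q$ of $(q)_{n+r+1} = (1 - q) (aq)_{n+r}$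
   is moved into [a]. *)
Definition bailey (q : F) (a : nat -> F) (n : nat) : F :=
  \sum_(r < n.+1) a r / (poch q 0 (n - r) * poch q 0 (n + r + e)).

Lemma poch_neq0 q a b : regular_base q -> poch q a b != 0.
Proof.
move=> hq; rewrite /poch prodf_seq_neq0; apply/allP => k _ /=.
by rewrite subr_eq0 eq_sym.
Qed.

(** The Bailey lemma with both free parameters sent to infinity. Once the sums are exchanged, the
    coefficients of [a r] agree by [gauss_vandermonde] at $n-r$ and $2r+e$. *)
Lemma bailey_step q a n : regular_base q ->
  bailey q (fun r => q ^+ (r * (r + e)) * a r) n =
  \sum_(s < n.+1) q ^+ (s * (s + e)) / poch q 0 (n - s) * bailey q a s.
Proof.
move=> hq; have nz := fun a b => poch_neq0 a b hq.
under [RHS]eq_bigr => s _.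
  rewrite /bailey (big_ord_widen n.+1 (fun r => a r / (poch q 0 (s - r) * poch q 0 (s + r + e)))) //.
  rewrite mulr_sumr.
  over.
rewrite (exchange_big_dep xpredT) //=; apply: eq_bigr => r _.
have rn : (r <= n)%N by have := ltn_ord r; lia.
rewrite (sum_ord_shift (fun s => q ^+ (s * (s + e)) / poch q 0 (n - s) *
   (a r / (poch q 0 (s - r) * poch q 0 (s + r + e))))) //.
rewrite -[LHS]mulr1 -[X in _ * X = _](gauss_vandermonde q (n - r) (2 * r + e)) mulr_sumr.
apply: eq_bigr => k _; have kn : (k <= n - r)%N by have := ltn_ord k; lia.
have := gbin_poch q k (n - r - k).
have -> : (k + (n - r - k) = n - r)%N by lia.
have -> : (n - r - k = n - (k + r))%N by lia.
have -> : (k + r - r = k)%N by lia.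
have -> : (k + r + r + e = k + (2 * r + e))%N by lia.
have -> : (n - r + (2 * r + e) = n + r + e)%N by lia.
have e2 : poch q 0 (k + (2 * r + e)) * poch q (k + (2 * r + e)) (n + r + e) =
          poch q 0 (n + r + e) by rewrite poch_cat //; lia.
have -> : ((k + r) * (k + r + e) = r * (r + e) + k * (k + (2 * r + e)))%N by lia.
rewrite exprD -e2 => e3; rewrite -e3.
have [[n1 n2] n3] := (nz 0%N k, nz 0%N (n - (k + r))%N, nz 0%N (k + (2 * r + e))%N).
have n4 := nz (k + (2 * r + e))%N (n + r + e)%N.
(* Rewriting with [e3] has put this binomial into a denominator. *)
have n5 : gbin q (n - r) k != 0.
  by have := nz 0%N (n - r)%N; rewrite -e3; apply: contraNneq => ->; rewrite mul0r.
by field; rewrite n1 n2 n3 n4 n5.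
Qed.

(** The finite triple product in Bailey form: the binomial theorem in base $q^b$ at $x=1$, $y=q^v$,
    folded by [sum_fold]. The positions $n+r+e$ and $n-r$ yield the exponents [E1 r] and [E2 r] once
    the common power $q^w$ is removed. It is applied with $b=1$, where the product vanishes, and
    with $b=5$. *)
Lemma bailey_gauss (q : F) (b v w n : nat) (E1 E2 : nat -> nat) :
  (e <= 1)%N -> regular_base (q ^+ b) ->
  (forall r, (r <= n)%N -> (b * 'C(n + r + e, 2) + v * (n - r) = E1 r + w)%N) ->
  (forall r, (r <= n)%N -> (b * 'C(n - r, 2) + v * (n + r + e) = E2 r + w)%N) ->
  (-1) ^+ (n + e) * q ^+ w * poch (q ^+ b) 0 (2 * n + e) *
    bailey (q ^+ b) (fun r => (-1) ^+ r * ((r + e != 0)%N%:R * q ^+ E1 r + (-1) ^+ e * q ^+ E2 r)) n =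
  \prod_(k < 2 * n + e) (q ^+ v - (q ^+ b) ^+ k).
Proof.
move=> e1 hq h1 h2; have nz := fun a c => poch_neq0 a c hq.
have := gauss_binomial_theorem (q ^+ b) (2 * n + e) 1 (q ^+ v).
under [X in _ = X -> _]eq_bigr do rewrite mul1r.
move=> <-.
rewrite (eq_bigr (fun i : 'I_(2 * n + e).+1 =>
  (-1) ^+ i * q ^+ (b * 'C(i, 2) + v * (2 * n + e - i)) * poch (q ^+ b) 0 (2 * n + e) /
  (poch (q ^+ b) 0 i * poch (q ^+ b) 0 (2 * n + e - i)))); last first.
  move=> i _; have := gbin_poch (q ^+ b) i (2 * n + e - i).
  have -> : (i + (2 * n + e - i) = 2 * n + e)%N by have := ltn_ord i; lia.
  move=> <-; rewrite expr1n mulr1 exprD !exprM.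
  by field; rewrite !nz.
rewrite (sum_fold (fun i => (-1) ^+ i * q ^+ (b * 'C(i, 2) + v * (2 * n + e - i)) *
  poch (q ^+ b) 0 (2 * n + e) / (poch (q ^+ b) 0 i * poch (q ^+ b) 0 (2 * n + e - i)))) //.
rewrite /bailey mulr_sumr; apply: eq_bigr => r _.
have rn : (r <= n)%N by have := ltn_ord r; lia.
have -> : (2 * n + e - (n + r + e) = n - r)%N by lia.
have -> : (2 * n + e - (n - r) = n + r + e)%N by lia.
rewrite h1 // h2 // -mulr_natl !exprD.
have sg : (-1) ^+ (n - r) = (-1) ^+ n * (-1) ^+ r :> F.
  rewrite -[in LHS]signr_odd oddB // signr_addb !signr_odd.
  by [].
rewrite sg.
set B := poch _ 0 (n - r); set C := poch _ 0 (n + r + e).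
have [n1 n2] : B != 0 /\ C != 0 by rewrite !nz.
have ee : (-1) ^+ e * (-1) ^+ e = 1 :> F by rewrite -expr2 sqrr_sign.
set s := (-1) ^+ e in ee *.
rewrite [RHS](_ : _ = (-1) ^+ n * q ^+ w * poch (q ^+ b) 0 (2 * n + e) * ((-1) ^+ r *
     ((r + e != 0)%N%:R * s * q ^+ E1 r + s * s * q ^+ E2 r) / (B * C))); last first.
  by rewrite ee; field; apply/andP.
by field; apply/andP.
Qed.

Lemma bailey_unit (q : F) n : (e <= 1)%N -> regular_base q -> q != 0 ->
  bailey q (unit_alpha e q) n = (n == 0)%N%:R.
Proof.
move=> e1 hq q0; have nz := fun a c => poch_neq0 a c hq.
case: n => [|n].
  rewrite /bailey big_ord_recl big_ord0 addr0 /unit_alpha /= addn0 !add0n expr0 mul1r.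
  case: e e1 => [|[|k]] // _.
    by rewrite /= mul0r add0r expr0 !pochnn mulr1 divr1.
  rewrite /= !expr1 mul1r pochnn mul1r expr0.
  rewrite /poch big_nat1 expr1 mulN1r divff // subr_eq0 eq_sym.
  exact: (hq 0%N).
(* This choice of [v] makes the factor of index $k=v$ vanish, and that index is in range. The value
   of [w] is read off at $r=0$. *)
have h := @bailey_gauss q 1 (n.+1 + e) ('C(n.+1 + e, 2) + (n.+1 + e) * n.+1) n.+1
  (fun r => 'C(r, 2)) (fun r => 'C((r + e).+1, 2)) e1.
rewrite expr1 in h; move: (h hq) => {}h.
(* Doubling removes the binomial coefficients and leaves polynomial arithmetic for [nia]. *)
have b2 m : (2 * 'C(m, 2) + m = m * m)%N.
  by elim: m => // m IH; rewrite binS bin1; lia.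
have /h {}h : forall r, (r <= n.+1)%N ->
   (1 * 'C(n.+1 + r + e, 2) + (n.+1 + e) * (n.+1 - r) =
    'C(r, 2) + ('C(n.+1 + e, 2) + (n.+1 + e) * n.+1))%N.
  move=> r /subnK; set t := (n.+1 - r)%N => ht.
  have := (b2 (n.+1 + r + e)%N, b2 r, b2 (n.+1 + e)%N); rewrite -ht => -[[]]; nia.
have /h {}h : forall r, (r <= n.+1)%N ->
   (1 * 'C(n.+1 - r, 2) + (n.+1 + e) * (n.+1 + r + e) =
    'C((r + e).+1, 2) + ('C(n.+1 + e, 2) + (n.+1 + e) * n.+1))%N.
  move=> r /subnK; set t := (n.+1 - r)%N => ht.
  have := (b2 t, b2 (r + e).+1, b2 (n.+1 + e)%N); rewrite -ht => -[[]].
  case: e e1 => [|[|k]] // _; nia.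
have lt : (n.+1 + e < 2 * n.+1 + e)%N by lia.
move: h; rewrite [X in _ = X](bigD1 (Ordinal lt)) //= subrr mul0r => /eqP.
rewrite !mulf_eq0 !expf_eq0 (negPf q0) (negPf (nz _ _)) oppr_eq0 oner_eq0 !andbF /=.
by move=> /eqP.
Qed.

(** The first step turns the unit sequence $\beta_n=\delta_{n0}$ into $1/(q)_n$, the second turns
    that into the finite Rogers-Ramanujan sum. *)
Lemma bailey_theta (q : F) n : (e <= 1)%N -> regular_base q -> q != 0 ->
  bailey q (theta_term e q) n =
  \sum_(s < n.+1) q ^+ (s * (s + e)) / (poch q 0 s * poch q 0 (n - s)).
Proof.
move=> e1 hq q0; have nz := fun a c => poch_neq0 a c hq.
pose a1 r := q ^+ (r * (r + e)) * unit_alpha e q r.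
transitivity (bailey q (fun r => q ^+ (r * (r + e)) * a1 r) n).
  by apply: eq_bigr => r _; rewrite /theta_term /a1 mulrA -exprD addnn -mul2n.
rewrite bailey_step //; apply: eq_bigr => s _.
rewrite /a1 bailey_step // big_ord_recl /= big1 ?addr0; last first.
  by move=> i _; rewrite bailey_unit // mulr0.
rewrite bailey_unit // subn0 mul0n expr0.
by rewrite eqxx mulr1; field; rewrite !nz.
Qed.

(** The classes modulo 5 found here are 3, 2 for $e=0$ and 1, 4 for $e=1$, complementary to those of
    the final product. The condition $0<n$ keeps the subtraction in [v] exact: at $n=e=0$ it would
    have to be $-2$. *)
Lemma bailey_theta5 (q : F) n : (e <= 1)%N -> regular_base q -> q != 0 -> (0 < n)%N ->
  poch (q ^+ 5) 0 (2 * n + e) * bailey (q ^+ 5) (theta_term e q) n =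
  \prod_(j < n + e) (1 - q ^+ (5 * j + (3 - 2 * e))) *
  \prod_(j < n) (1 - q ^+ (5 * j + (2 + 2 * e))).
Proof.
move=> e1 hq q0 n0.
have hq5 : regular_base (q ^+ 5).
  by move=> m; rewrite -exprM (_ : 5 * m.+1 = (5 * m + 4).+1)%N //; lia.
(* The choice of [v] makes $5 \binom{n+r+e}{2} + v (n - r)$ the exponent in [theta_term]. *)
pose v := (5 * (n + e) - 2 - 2 * e)%N.
pose w := (5 * 'C(n + e, 2) + v * n)%N.
have b2 m : (2 * 'C(m, 2) + m = m * m)%N.
  by elim: m => // m IH; rewrite binS bin1; lia.
have := @bailey_gauss q 5 v w n
  (fun r => 2 * (r * (r + e)) + 'C(r, 2))%N (fun r => 2 * (r * (r + e)) + 'C((r + e).+1, 2))%N e1 hq5.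
have hv : (v + (2 + 2 * e) = 5 * (n + e))%N by rewrite /v; lia.
have h1 r : (r <= n)%N ->
   (5 * 'C(n + r + e, 2) + v * (n - r) = 2 * (r * (r + e)) + 'C(r, 2) + w)%N.
  rewrite /w; move=> /subnK; set t := (n - r)%N => ht.
  have := (b2 (n + r + e)%N, b2 r, b2 (n + e)%N); move: hv; rewrite -ht => hv -[[]].
  by case: e e1 hv => [|[|k]] // _; nia.
have h2 r : (r <= n)%N ->
   (5 * 'C(n - r, 2) + v * (n + r + e) = 2 * (r * (r + e)) + 'C((r + e).+1, 2) + w)%N.
  rewrite /w; move=> /subnK; set t := (n - r)%N => ht.
  have := (b2 t, b2 (r + e).+1, b2 (n + e)%N); move: hv; rewrite -ht => hv -[[]].
  by case: e e1 hv => [|[|k]] // _; nia.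
move=> /(_ h1 h2).
have -> : bailey (q ^+ 5) (fun r => (-1) ^+ r * ((r + e != 0)%N%:R *
     q ^+ (2 * (r * (r + e)) + 'C(r, 2)) + (-1) ^+ e * q ^+ (2 * (r * (r + e)) + 'C((r + e).+1, 2)))) n
   = bailey (q ^+ 5) (theta_term e q) n.
  apply: eq_bigr => r _; congr (_ / _).
  by rewrite /theta_term /unit_alpha !exprD; ring.
rewrite -(big_mkord xpredT (fun k => q ^+ v - (q ^+ 5) ^+ k)).
(* Since $5(n+e-1)<v<5(n+e)$, the power that can be taken out of $q^v-q^{5k}$ is $q^{5k}$ for
   $k<n+e$ and $q^v$ from there on. *)
rewrite (@big_cat_nat _ _ _ (n + e)) /=; [|lia|lia].
have -> : \prod_(n + e <= i < 2 * n + e) (q ^+ v - q ^+ 5 ^+ i) =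
    \prod_(j < n) (q ^+ v * (1 - q ^+ (5 * j + (2 + 2 * e)))).
  rewrite -{1}[(n + e)%N]add0n big_addn.
  have -> : (2 * n + e - (n + e) = n)%N by lia.
  rewrite big_mkord; apply: eq_bigr => j _.
  by rewrite mulrBr mulr1 -exprD -exprM; congr (_ - q ^+ _); lia.
rewrite big_mkord big_split /= prodr_const card_ord -exprM.
have -> : \prod_(i < n + e) (q ^+ v - (q ^+ 5) ^+ i) =
   (-1) ^+ (n + e) * q ^+ (5 * 'C(n + e, 2)) * \prod_(j < n + e) (1 - q ^+ (5 * j + (3 - 2 * e))).
  rewrite (eq_bigr (fun i : 'I_(n + e) => (-1) * (q ^+ 5) ^+ i * (1 - q ^+ (v - 5 * i)))); last first.
    move=> i _; rewrite -exprM.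
    have {1}-> : v = (5 * i + (v - 5 * i))%N by have := ltn_ord i; rewrite /v; lia.
    by rewrite exprD; ring.
  rewrite !big_split /= prodr_const card_ord; congr (_ * _ * _).
    by rewrite (prodrXr (q ^+ 5)) -bin2_sum exprM big_mkord.
  rewrite (reindex_inj rev_ord_inj) /=; apply: eq_bigr => j _; congr (1 - q ^+ _).
  have := ltn_ord j; rewrite /v; lia.
set B := bailey _ _ _; set P := poch _ _ _; set P1 := \prod_(_ < n + e) _; set P2 := \prod_(_ < n) _.
move=> h.
have nz : (-1) ^+ (n + e) * q ^+ w != 0 :> F.
  by rewrite mulf_neq0 // expf_neq0 // oppr_eq0 oner_eq0.
apply: (mulfI nz); rewrite mulrA h /w [q ^+ (_ + _)]exprD; ring.
Qed.

End BaileyChain.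

(** * Rogers-Ramanujan identities modulo a power of q *)

Lemma rmorph_poch (A B : comNzRingType) (f : {rmorphism A -> B}) q a b :
  f (poch q a b) = poch (f q) a b.
Proof.
by rewrite rmorph_prod; apply: eq_bigr => k _; rewrite rmorphB rmorph1 rmorphXn.
Qed.

Lemma rmorph_theta_term (A B : comNzRingType) (f : {rmorphism A -> B}) e q r :
  f (theta_term e q r) = theta_term e (f q) r.
Proof.
by rewrite /theta_term /unit_alpha !(rmorphM, rmorphD, rmorphXn, rmorphN, rmorph1, rmorph_nat).
Qed.

Lemma specialize_genericX (A : comNzRingType) (q : A) :
  exists f : {rmorphism {poly int} -> A}, f 'X = q.
Proof.
exists (horner_eval q \o map_poly intr : {rmorphism {poly int} -> A}).
by rewrite /= map_polyX /horner_eval hornerX.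
Qed.

Section ThetaIdentities.
Variables (e : nat) (e1 : (e <= 1)%N).

(** The Bailey weight $1/((q)_{n-r}(q)_{n+r+e})$ times $(q)_n(q)_{2n+e}$, which clears the
    denominators for all $r\le n$ at once. It is congruent to 1 modulo $q^{n-r+1}$. *)
Definition window (A : comNzRingType) (q : A) (n r : nat) : A :=
  poch q (n - r) n * poch q (n + r + e) (2 * n + e).

Lemma window_bailey (F : fieldType) (q : F) (a : nat -> F) n : regular_base q ->
  \sum_(r < n.+1) a r * window q n r = poch q 0 n * poch q 0 (2 * n + e) * bailey e q a n.
Proof.
move=> hq; rewrite /bailey mulr_sumr; apply: eq_bigr => r _.
have rn : (r <= n)%N by have := ltn_ord r; lia.
rewrite /window -(@poch_cat _ q 0 (n - r) n); last lia.
rewrite -(@poch_cat _ q 0 (n + r + e) (2 * n + e)); last lia.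
by field; rewrite !poch_neq0.
Qed.

Lemma poch_ratio (F : fieldType) (q : F) m n s : regular_base q -> (s <= n <= m)%N ->
  poch q (n - s) n * poch q s m = poch q 0 n * poch q 0 m / (poch q 0 s * poch q 0 (n - s)).
Proof.
move=> hq sn; rewrite -(@poch_cat _ q 0 (n - s) n); last lia.
rewrite -(@poch_cat _ q 0 s m); last lia.
by field; rewrite !poch_neq0.
Qed.

Definition genericX : {fraction {poly int}} := tofrac ('X : {poly int}).

Lemma genericX_neq0 : genericX != 0.
Proof. by rewrite tofrac_eq0 polyX_eq0. Qed.

Lemma genericX_regular : regular_base genericX.
Proof.
move=> n; rewrite -rmorphXn -(rmorph1 (@tofrac _)) tofrac_eq.
by apply/eqP => /(congr1 (fun p : {poly int} => size p)); rewrite size_polyXn size_poly1.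
Qed.

(** Shown for the generic $X$ in the fraction field, where [bailey_theta] applies; injectivity of
    [tofrac] brings it down to $\mathbb Z[X]$, and $X\mapsto q$ carries it to any ring. *)
Lemma theta_window (A : comNzRingType) (q : A) n :
  \sum_(r < n.+1) theta_term e q r * window q n r =
  \sum_(s < n.+1) q ^+ (s * (s + e)) * (poch q (n - s) n * poch q s (2 * n + e)).
Proof.
suff H : \sum_(r < n.+1) theta_term e ('X : {poly int}) r * window 'X n r =
  \sum_(s < n.+1) 'X ^+ (s * (s + e)) * (poch 'X (n - s) n * poch 'X s (2 * n + e)).
  have [f fX] := specialize_genericX q; have := congr1 f H.
  rewrite !rmorph_sum; set l := \sum_(_ < _) _; set r := \sum_(_ < _) _ => lr.
  transitivity l; last transitivity r => //; apply: eq_bigr => i _.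
    by rewrite rmorphM rmorph_theta_term rmorphM !rmorph_poch fX.
  by rewrite rmorphM rmorphXn rmorphM !rmorph_poch fX.
apply/eqP; rewrite -tofrac_eq; apply/eqP; rewrite !rmorph_sum.
transitivity (\sum_(r < n.+1) theta_term e genericX r * window genericX n r).
  by apply: eq_bigr => r _; rewrite rmorphM rmorph_theta_term rmorphM !rmorph_poch.
have hq := genericX_regular.
rewrite window_bailey // bailey_theta ?genericX_neq0 // mulr_sumr.
apply: eq_bigr => s _; rewrite rmorphM rmorphXn rmorphM !rmorph_poch -/genericX.
by rewrite mulrCA -poch_ratio //; have := ltn_ord s; lia.
Qed.

Lemma theta_window5 (A : comNzRingType) (q : A) n : (0 < n)%N ->
  \sum_(r < n.+1) theta_term e q r * window (q ^+ 5) n r =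
  poch (q ^+ 5) 0 n * (\prod_(j < n + e) (1 - q ^+ (5 * j + (3 - 2 * e))) *
  \prod_(j < n) (1 - q ^+ (5 * j + (2 + 2 * e)))).
Proof.
move=> n0.
suff H : \sum_(r < n.+1) theta_term e ('X : {poly int}) r * window ('X ^+ 5) n r =
  poch ('X ^+ 5) 0 n * (\prod_(j < n + e) (1 - 'X ^+ (5 * j + (3 - 2 * e))) *
  \prod_(j < n) (1 - 'X ^+ (5 * j + (2 + 2 * e)))).
  have [f fX] := specialize_genericX q; have := congr1 f H.
  rewrite rmorph_sum [X in _ = X]rmorphM [X in _ * X]rmorphM rmorph_poch !rmorph_prod rmorphXn fX.
  rewrite [X in _ * (X * _)](eq_bigr (fun j : 'I_(n + e) => 1 - q ^+ (5 * j + (3 - 2 * e)))); last first.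
    by move=> j _; rewrite rmorphB rmorph1 rmorphXn fX.
  rewrite [X in _ * (_ * X)](eq_bigr (fun j : 'I_n => 1 - q ^+ (5 * j + (2 + 2 * e)))); last first.
    by move=> j _; rewrite rmorphB rmorph1 rmorphXn fX.
  move=> <-; apply: eq_bigr => i _.
  by rewrite rmorphM rmorph_theta_term rmorphM !rmorph_poch rmorphXn fX.
apply/eqP; rewrite -tofrac_eq; apply/eqP; rewrite !rmorph_sum.
transitivity (\sum_(r < n.+1) theta_term e genericX r * window (genericX ^+ 5) n r).
  apply: eq_bigr => r _.
  by rewrite rmorphM rmorph_theta_term rmorphM !rmorph_poch rmorphXn.
have hq := genericX_regular.
have hq5 : regular_base (genericX ^+ 5).
  by move=> m; rewrite -exprM (_ : 5 * m.+1 = (5 * m + 4).+1)%N //; lia.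
rewrite window_bailey // -mulrA bailey_theta5 ?genericX_neq0 //.
rewrite !rmorphM rmorph_poch !rmorph_prod rmorphXn; congr (_ * (_ * _)).
  by apply: eq_bigr => j _; rewrite rmorphB rmorph1 rmorphXn.
by apply: eq_bigr => j _; rewrite rmorphB rmorph1 rmorphXn.
Qed.

End ThetaIdentities.

Section TruncatedRogersRamanujan.
Variables (A : comNzRingType) (q : A).

Definition eqmodq (m : nat) (a b : A) := exists c, a = b + q ^+ m * c.

Lemma eqmodq_refl m a : eqmodq m a a.
Proof. by exists 0; rewrite mulr0 addr0. Qed.

Lemma eqmodq_sym m a b : eqmodq m a b -> eqmodq m b a.
Proof. by case=> c ->; exists (- c); rewrite mulrN addrK. Qed.

Lemma eqmodq_trans m a b c : eqmodq m a b -> eqmodq m b c -> eqmodq m a c.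
Proof. by case=> x -> [y ->]; exists (y + x); rewrite mulrDr addrA. Qed.

Lemma eqmodqM m a b c d : eqmodq m a b -> eqmodq m c d -> eqmodq m (a * c) (b * d).
Proof. by case=> x -> [y ->]; exists (x * d + b * y + q ^+ m * x * y); ring. Qed.

Lemma eqmodq_sum m (I : Type) (s : seq I) (P : pred I) (f g : I -> A) :
  (forall i, P i -> eqmodq m (f i) (g i)) ->
  eqmodq m (\sum_(i <- s | P i) f i) (\sum_(i <- s | P i) g i).
Proof.
move=> h; elim/big_rec2: _ => [|i x y Pi [c ->]]; first exact: eqmodq_refl.
by have [d ->] := h i Pi; exists (d + c); ring.
Qed.

Lemma eqmodq_scale m k j a b c : (m <= k + j)%N -> eqmodq j a b ->
  eqmodq m (q ^+ k * c * a) (q ^+ k * c * b).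
Proof.
move=> mkj [x ->]; exists (q ^+ (k + j - m) * c * x).
by rewrite !mulrA -exprD subnKC // exprD; ring.
Qed.

Lemma poch_eqmodq (b m a c : nat) : (m <= b * a.+1)%N -> eqmodq m (poch (q ^+ b) a c) 1.
Proof.
move=> mba; rewrite /poch big_nat_cond.
elim/big_rec: _ => [|k x /andP[/andP[ak _] _] hx]; first exact: eqmodq_refl.
rewrite -[X in eqmodq _ _ X]mulr1; apply: eqmodqM hx; exists (- q ^+ (b * k.+1 - m)).
have bk : (m <= b * k.+1)%N by apply: (leq_trans mba); rewrite leq_mul2l ltnS ak orbT.
by rewrite mulrN -exprD subnKC // exprM.
Qed.

End TruncatedRogersRamanujan.

(** Each exponent from 1 to $5n+e$ occurs once, sorted by its class modulo 5. For $e=1$ the longer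
    product supplies the last one, $5n+1$. *)
Lemma poch5_dissect (A : comNzRingType) (q : A) e n : (e <= 1)%N ->
  poch (q ^+ 5) 0 n * (\prod_(j < n + e) (1 - q ^+ (5 * j + (3 - 2 * e))) *
  \prod_(j < n) (1 - q ^+ (5 * j + (2 + 2 * e)))) *
  \prod_(j < n) ((1 - q ^+ (5 * j + (1 + e))) * (1 - q ^+ (5 * j + (4 - e)))) =
  poch q 0 (5 * n + e).
Proof.
move=> e1; elim: n => [|n IHn].
  rewrite !big_ord0 muln0 !add0n pochnn mul1r !mulr1.
  case: e e1 => [|[|k]] // _; first by rewrite big_ord0 pochnn.
  by rewrite big_ord_recl big_ord0 mulr1 /poch big_nat1.
have -> : (5 * n.+1 + e = (5 * n + e).+1.+4)%N by lia.
rewrite !addSn !big_ord_recr /= 6?(@pochSr _ _ 0) // -IHn -exprM.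
case: e e1 {IHn} => [|[|k]] // _.
  have -> : (5 * n.+1 = (5 * n + 0).+1.+4)%N by lia.
  rewrite !addn0 !muln0 !subn0 !addnS !addn0.
  (* With the powers turned into variables, [ring] only has to permute factors. *)
  move: (q ^+ (5 * n).+1) (q ^+ (5 * n).+2) (q ^+ (5 * n).+3) (q ^+ (5 * n).+4).
  by move: (q ^+ _) => ?????; ring.
have -> : (5 * n.+1 = (5 * n).+1.+4)%N by lia.
rewrite addn1 (_ : 5 * n.+1 + _ = (5 * n).+1.+4.+1)%N; last lia.
rewrite !addnS !addn0.
move: (q ^+ (5 * n).+2) (q ^+ (5 * n).+3) (q ^+ (5 * n).+4) (q ^+ (5 * n).+1.+4).
move: (q ^+ _) => ?????; ring.
Qed.

(** Modulo $q^{n+1}$ the windows in base $q$ and in base $q^5$ both become 1, so the two evaluations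
    are of the same partial theta sum. The dissection of $(q)_{5n+e}$ then moves the classes of
    [bailey_theta5] to the other side. *)
Theorem truncated_rogers_ramanujan (A : comNzRingType) (q : A) e n :
  (e <= 1)%N -> (0 < n)%N ->
  eqmodq q n.+1
    ((\sum_(s < n.+1) q ^+ (s * (s + e)) * poch q s n) *
     \prod_(j < n) ((1 - q ^+ (5 * j + (1 + e))) * (1 - q ^+ (5 * j + (4 - e)))))
    (poch q 0 n).
Proof.
move=> e1 n0; have q1 := expr1 q.
have theta_eq b : (0 < b)%N -> eqmodq q n.+1
    (\sum_(r < n.+1) theta_term e q r * window e (q ^+ b) n r)
    (\sum_(r < n.+1) theta_term e q r).
  move=> b0; apply: eqmodq_sum => r _.
  have rn : (r <= n)%N by have := ltn_ord r; lia.
  (* The window is 1 only modulo $q^{n-r+1}$; the factor $q^r$ of the theta term makes up the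
     difference. The sum side below uses $q^{s(s+e)}$ in the same way. *)
  have -> : theta_term e q r = q ^+ r * (q ^+ (2 * (r * (r + e)) - r) * unit_alpha e q r).
    by rewrite mulrA -exprD subnKC //; nia.
  rewrite -[X in eqmodq _ _ _ X]mulr1.
  apply: (@eqmodq_scale _ _ _ _ (n - r).+1); first by lia.
  rewrite -[1]mulr1; apply: eqmodqM; apply: poch_eqmodq; nia.
have h1 : eqmodq q n.+1 (\sum_(r < n.+1) theta_term e q r)
             (\sum_(s < n.+1) q ^+ (s * (s + e)) * poch q s n).
  have := eqmodq_sym (theta_eq 1%N isT); rewrite q1 theta_window // => h.
  apply: (eqmodq_trans h); apply: eqmodq_sum => s _.
  have sn : (s <= n)%N by have := ltn_ord s; lia.
  rewrite -[q ^+ _]mulr1; apply: (@eqmodq_scale _ _ _ _ (n - s).+1); first by nia.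
  rewrite -[X in eqmodq _ _ _ X]mul1r; apply: eqmodqM.
    by rewrite -q1; apply: poch_eqmodq; lia.
  rewrite -(@poch_cat _ q s n); last lia.
  rewrite -[X in eqmodq _ _ _ X]mulr1; apply: eqmodqM; first exact: eqmodq_refl.
  by rewrite -q1; apply: poch_eqmodq; lia.
have := theta_eq 5%N isT; rewrite theta_window5 // => h5.
have h2 := eqmodq_sym (eqmodq_trans h5 h1).
apply: (eqmodq_trans (eqmodqM h2 (eqmodq_refl _ _ _))).
rewrite poch5_dissect // -(@poch_cat _ q 0 n); last lia.
rewrite -[X in eqmodq _ _ _ X]mulr1; apply: eqmodqM; first exact: eqmodq_refl.
by rewrite -q1; apply: poch_eqmodq; lia.
Qed.

(** * The ring of power q-sums *)

Lemma fsum_seq (V : nmodType) (T : choiceType) (A : set T) (r : seq T) (f : T -> V) :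
  uniq r -> (forall i, A i -> f i != 0 -> i \in r) ->
  \sum_(i \in A) f i = \sum_(i <- r | i \in A) f i.
Proof.
move=> ur h; rewrite [RHS]bigfs ?set_mem_set // => i /set_mem Ai.
by apply: contraNeq; exact: h.
Qed.

Section Parts.
Variables (R : comNzRingType) (H : nmodType).

Definition dec_finite := forall d : H, finite_set [set x : H * H | x.1 + x.2 = d].

(** The interval below [d] for the order given by addition. It is closed under taking summands
    ([parts_trans]), on which every truncation rests. *)
Definition parts (d : H) : seq H := fset_set (fst @` [set x : H * H | x.1 + x.2 = d]).

Hypothesis fin : dec_finite.

Lemma partsP d a : reflect (exists b, a + b = d) (a \in parts d).
Proof.
rewrite /parts in_fset_set; last exact: finite_image.
apply: (iffP idP) => [/set_mem[[x y] /= xy <-]|[b ab]]; first by exists y.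
by apply/mem_set; exists (a, b).
Qed.

Lemma partsPl d a b : a + b = d -> a \in parts d.
Proof. by move=> ab; apply/partsP; exists b. Qed.

Lemma partsPr d a b : a + b = d -> b \in parts d.
Proof. by rewrite addrC; exact: partsPl. Qed.

Lemma parts_self d : d \in parts d.
Proof. by apply: (@partsPl _ _ 0); rewrite addr0. Qed.

Lemma parts_trans d e a : a \in parts e -> e \in parts d -> a \in parts d.
Proof. by move=> /partsP[b <-] /partsP[c <-]; apply: (@partsPl _ _ (b + c)); rewrite addrA. Qed.

Lemma parts_uniq d : uniq (parts d). Proof. exact: fset_uniq. Qed.

(** One index set serves all coefficients [e] below [d], so sums can be exchanged and products
    compared without dependent ranges. *)
Lemma qmul_parts (f g : qsum R H) d e : e \in parts d ->
  qmul f g e = \sum_(a <- parts d) \sum_(b <- parts d) (f a * g b) *+ (a + b == e).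
Proof.
move=> ed.
rewrite /qmul (@fsum_seq _ _ _ [seq (a, b) | a <- parts d, b <- parts d]).
- rewrite big_mkcond big_allpairs; apply: eq_bigr => a _; apply: eq_bigr => b _ /=.
  case: ifPn => [/set_mem /= ->|]; first by rewrite eqxx.
  by case: eqP => [abe /negP[]|//]; apply/mem_set.
- by rewrite allpairs_uniq ?parts_uniq // => -[? ?] [? ?].
move=> [a b] /= abe _; apply/allpairsP; exists (a, b); split=> //=.
  by apply: parts_trans ed; exact: partsPl abe.
by apply: parts_trans ed; exact: partsPr abe.
Qed.

Lemma qmulE (f g : qsum R H) d :
  qmul f g d = \sum_(a <- parts d) \sum_(b <- parts d) (f a * g b) *+ (a + b == d).
Proof. exact: qmul_parts (parts_self d). Qed.

Lemma qmulC : commutative (@qmul R H).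
Proof.
move=> f g; apply: funext => d; rewrite !qmulE exchange_big.
by apply: eq_bigr => a _; apply: eq_bigr => b _; rewrite mulrC addrC.
Qed.

Lemma qmulDl : left_distributive (@qmul R H) (fun f g d => f d + g d).
Proof.
move=> f g h; apply: funext => d; rewrite !qmulE -big_split; apply: eq_bigr => a _ /=.
by rewrite -big_split; apply: eq_bigr => b _ /=; rewrite mulrDl mulrnDl.
Qed.

(** Cancellation is asked for this [a] only: at $a=0$ it is automatic, which yields the unit law in
    every [H]. *)
Lemma qmul_expl (f : qsum R H) a d : (forall x y : H, a + x = a + y -> x = y) ->
  forall b, a + b = d -> qmul (qexp R a) f d = f b.
Proof.
move=> inj b abd; rewrite qmulE (bigD1_seq a) ?parts_uniq ?(partsPl abd) //=.
rewrite [X in _ + X]big1 ?addr0; last first.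
  by move=> x xa; rewrite big1 // => y _; rewrite /qexp (negPf xa) mul0r mul0rn.
rewrite (bigD1_seq b) ?parts_uniq ?(partsPr abd) //= big1.
  by rewrite abd eqxx /qexp eqxx mul1r addr0.
move=> y yb; case: eqP => // ayd; case/eqP: yb; apply: inj; by rewrite ayd.
Qed.

Lemma qmul_expl0 (f : qsum R H) a d : a \notin parts d -> qmul (qexp R a) f d = 0.
Proof.
move=> ad; rewrite qmulE big_seq big1 // => x xd; rewrite big1 // => y _.
rewrite /qexp; case: eqP => [xa|]; last by rewrite mul0r mul0rn.
by rewrite -xa xd in ad.
Qed.

Lemma qmul1l : left_id (@qone R H) (@qmul R H).
Proof.
move=> f; apply: funext => d; apply: qmul_expl; last exact: add0r.
by move=> x y; rewrite !add0r.
Qed.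

Lemma qmulA : associative (@qmul R H).
Proof.
(* The triple sum is symmetric, so commutativity reduces the other bracketing to this one. *)
suff E (f g h : qsum R H) d : qmul (qmul f g) h d =
    \sum_(a <- parts d) \sum_(b <- parts d) \sum_(c <- parts d)
      (f a * g b * h c) *+ (a + b + c == d).
  move=> f g h; apply: funext => d; rewrite E qmulC E.
  under [LHS]eq_bigr do rewrite exchange_big.
  rewrite exchange_big; apply: eq_bigr => a _; apply: eq_bigr => b _; apply: eq_bigr => c _ /=.
  by rewrite mulrC mulrA [b + c + a]addrC addrA.
rewrite qmulE.
transitivity (\sum_(x <- parts d) \sum_(c <- parts d) \sum_(a <- parts d) \sum_(b <- parts d)
   (f a * g b * h c) *+ (a + b == x) *+ (x + c == d)).
  rewrite big_seq [RHS]big_seq; apply: eq_bigr => x xd; apply: eq_bigr => c _.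
  rewrite (qmul_parts f g xd) mulr_suml -sumrMnl; apply: eq_bigr => a _.
  by rewrite mulr_suml -sumrMnl; apply: eq_bigr => b _; rewrite mulrnAl.
rewrite exchange_big /=; under eq_bigr => c _.
  rewrite exchange_big /=.
  under eq_bigr do rewrite exchange_big /=.
  over.
rewrite exchange_big /=; apply: eq_bigr => a _; rewrite exchange_big /=.
apply: eq_bigr => b _; apply: eq_bigr => c _.
have [abc|abc] := eqVneq (a + b + c) d; last first.
  rewrite big1 // => x _; have [abx|] := eqVneq (a + b) x; last by rewrite mulr0n mul0rn.
  by rewrite -abx (negPf abc).
rewrite (bigD1_seq (a + b)) ?parts_uniq ?(partsPl abc) //= eqxx abc eqxx big1 ?addr0 //.
by move=> x; rewrite eq_sym => /negPf->; rewrite mul0rn.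
Qed.

Lemma qone_neq0 : @qone R H <> (fun=> 0).
Proof.
move=> /(congr1 (fun f => f 0)); rewrite /qone /qexp eqxx => /eqP.
by rewrite oner_eq0.
Qed.

End Parts.

(* [qsum R H], as a ring; the phantom argument carries the finiteness of decompositions. *)
Definition qring (R : comNzRingType) (H : nmodType) (fin : dec_finite H) := qsum R H.

Section QRing.
Variables (R : comNzRingType) (H : nmodType) (fin : dec_finite H).
Local Notation Q := (qring R fin).

HB.instance Definition _ := GRing.Zmodule.copy Q (H -> R).

HB.instance Definition _ := GRing.Zmodule_isComNzRing.Build Q
  (qmulA fin : associative (@qmul R H : Q -> Q -> Q))
  (qmulC fin : commutative (@qmul R H : Q -> Q -> Q))
  (qmul1l fin : left_id (@qone R H : Q) (@qmul R H : Q -> Q -> Q))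
  (qmulDl fin : left_distributive (@qmul R H : Q -> Q -> Q) +%R)
  (introN eqP (@qone_neq0 R H) : (@qone R H : Q) != 0).

Lemma qring_mulE (f g : Q) : f * g = qmul f g. Proof. by []. Qed.
Lemma qring_subE (f g : Q) : f - g = qsub f g. Proof. by []. Qed.

End QRing.

Section Truncation.
Variables (R : comNzRingType) (H : nmodType) (fin : dec_finite H).
Hypothesis addI : forall a x y : H, a + x = a + y -> x = y.
Hypothesis conical : forall a b : H, a + b = 0 -> a = 0.
Local Notation Q := (qring R fin).

Lemma natmul_eq0 (a : H) n : a *+ n.+1 = 0 -> a = 0.
Proof. by rewrite mulrS => /conical. Qed.

Lemma natmulI (a : H) : a != 0 -> injective (fun n => a *+ n).
Proof.
move=> a0; elim=> [|m IHm] [|n] //= e.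
- by move: e; rewrite mulr0n => /esym/natmul_eq0/eqP; rewrite (negPf a0).
- by move: e; rewrite mulr0n => /natmul_eq0/eqP; rewrite (negPf a0).
by congr S; apply: IHm; apply: (@addI a); rewrite -!mulrS.
Qed.

(** The multiples $0,a,\dots,(n-1)a$ are distinct summands of [d], so their number is bounded
    independently of [a]. *)
Lemma natmul_parts_bounded (d : H) :
  exists N, forall (a : H) n, a != 0 -> a *+ n \in parts d -> (n <= N)%N.
Proof.
exists (size (parts d)) => a n a0 and_.
have -> : n = size [seq a *+ i | i <- iota 0 n] by rewrite size_map size_iota.
apply: uniq_leq_size; first by rewrite (map_inj_uniq (natmulI a0)) iota_uniq.
move=> _ /mapP[k + ->]; rewrite mem_iota => /andP[_ kn].
apply: (parts_trans fin _ and_).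
by apply: (@partsPl _ fin _ _ (a *+ (n - k))); rewrite -mulrnDr subnKC // ltnW.
Qed.

(** Congruence modulo the sums supported outside [parts d]; these form an ideal because [parts d] is
    closed under taking summands. *)
Definition eqd (d : H) (f g : Q) := {in parts d, f =1 g}.

Lemma eqd_eq (f g : Q) : (forall d, eqd d f g) -> f = g.
Proof. by move=> h; apply: funext => d; apply: (h d); exact: parts_self. Qed.

Lemma eqd_sym d f g : eqd d f g -> eqd d g f.
Proof. by move=> h e ed; rewrite h. Qed.

Lemma eqd_trans d f g h : eqd d f g -> eqd d g h -> eqd d f h.
Proof. by move=> fg gh e ed; rewrite fg // gh. Qed.

Lemma eqd_refl d f : eqd d f f. Proof. by []. Qed.

Lemma eqdD d (f f' g g' : Q) : eqd d f f' -> eqd d g g' -> eqd d (f + g) (f' + g').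
Proof. by move=> hf hg e ed; rewrite /GRing.add /= -/(f e + g e) -/(f' e + g' e) hf // hg. Qed.

Lemma eqdM d (f f' g g' : Q) : eqd d f f' -> eqd d g g' -> eqd d (f * g) (f' * g').
Proof.
move=> hf hg e ed; rewrite !qring_mulE !(qmul_parts fin _ _ ed).
rewrite big_seq [RHS]big_seq; apply: eq_bigr => a ad.
by rewrite big_seq [RHS]big_seq; apply: eq_bigr => b bd; rewrite hf // hg.
Qed.

Lemma eqd_prod d (I : eqType) (s : seq I) (f g : I -> Q) :
  (forall i, i \in s -> eqd d (f i) (g i)) -> eqd d (\prod_(i <- s) f i) (\prod_(i <- s) g i).
Proof.
elim: s => [|i s IHs] h; first by rewrite !big_nil.
rewrite !big_cons; apply: eqdM; first by apply: h; rewrite inE eqxx.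
by apply: IHs => j js; apply: h; rewrite inE js orbT.
Qed.

Lemma eqd_sum d (I : eqType) (s : seq I) (f g : I -> Q) :
  (forall i, i \in s -> eqd d (f i) (g i)) -> eqd d (\sum_(i <- s) f i) (\sum_(i <- s) g i).
Proof.
elim: s => [|i s IHs] h; first by rewrite !big_nil.
rewrite !big_cons; apply: eqdD; first by apply: h; rewrite inE eqxx.
by apply: IHs => j js; apply: h; rewrite inE js orbT.
Qed.

Lemma eqd_exp0 d a (f : Q) : a \notin parts d -> eqd d ((qexp R a : Q) * f) 0.
Proof.
move=> ad e ed; rewrite qring_mulE qmul_expl0 //.
by apply: contra ad => ae; exact: parts_trans ae ed.
Qed.

Lemma qexpD a b : (qexp R (a + b) : Q) = (qexp R a : Q) * qexp R b.
Proof.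
apply: funext => d; rewrite qring_mulE.
have [/(partsP fin)[x <-]|ad] := boolP (a \in parts d).
  rewrite (@qmul_expl R H fin _ a (a + x) (@addI a) x erefl).
  by rewrite /qexp; congr ((nat_of_bool _)%:R); apply/eqP/eqP => [/addI|->].
rewrite qmul_expl0 // /qexp; case: eqP => // abd.
by case/negP: ad; apply: (@partsPl _ fin _ _ b).
Qed.

Lemma qexpMn a n : (qexp R (a *+ n) : Q) = (qexp R a : Q) ^+ n.
Proof.
by elim: n => [|n IHn]; rewrite ?mulr0n ?expr0 // mulrS qexpD IHn exprS.
Qed.

Lemma qgeomE (a d : H) : a != 0 -> qgeom R a d = `[< exists n, d = a *+ n >]%:R.
Proof.
move=> a0; rewrite /qgeom /qseries; case: asboolP => [[n ->]|h].
  rewrite (@fsum_seq _ _ _ [:: n]) //; last first.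
    move=> i _; rewrite inE /qexp; have [/(natmulI a0) -> //|] := eqVneq (a *+ n) (a *+ i).
    by rewrite eqxx.
  by rewrite big_mkcond big_seq1 in_setT /qexp eqxx.
apply: fsbig1 => n _; rewrite /qexp; case: eqP => // dn; case: h; by exists n.
Qed.

Lemma qgeom_inv a : a != 0 -> (1 - (qexp R a : Q)) * (qgeom R a : Q) = 1.
Proof.
move=> a0; rewrite mulrBl mul1r; apply: funext => d.
rewrite qring_mulE qring_subE /qsub qgeomE //.
have -> : (1 : Q) d = (d == 0)%:R by [].
have [/(partsP fin)[x <-]|ad] := boolP (a \in parts d).
  rewrite (@qmul_expl R H fin _ a (a + x) (@addI a) x erefl).
  rewrite qgeomE // (_ : `[< _ >] = `[< exists n, x = a *+ n >]); last first.
    apply: asbool_equiv_eq; split=> [[[|n]]|[n ->]]; last by exists n.+1; rewrite mulrS.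
      by rewrite mulr0n => /conical/eqP; rewrite (negPf a0).
    by rewrite mulrS => /addI; exists n.
  rewrite subrr; case: eqP => // /conical/eqP; by rewrite (negPf a0).
rewrite qmul_expl0 // subr0; congr ((nat_of_bool _)%:R); apply/asboolP/eqP => [[[|n] dn]|->].
- by rewrite dn mulr0n.
- by case/negP: ad; apply: (@partsPl _ fin _ _ (a *+ n)); rewrite -mulrS.
by exists 0%N; rewrite mulr0n.
Qed.

Lemma qgeom_eqd1 d a : a != 0 -> a \notin parts d -> eqd d (qgeom R a) 1.
Proof.
move=> a0 ad; rewrite -(qgeom_inv a0) mulrBl mul1r -[X in eqd d X]addr0.
apply: eqdD; first exact: eqd_refl.
move=> e ed; have := eqd_exp0 (qgeom R a) ad ed.
by move=> h; rewrite -[LHS]oppr0; congr (- _); rewrite h.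
Qed.

Lemma qinv_eq (f g : Q) : f * g = 1 -> qinv f = g.
Proof.
move=> fg; apply: xget_unique => // h /= fh.
have {}fh : f * h = 1 by [].
by rewrite -[h](@mul1r Q) -fg mulrAC fh mul1r.
Qed.

End Truncation.

(** * Infinite products *)

Section Products.
Variables (R : comNzRingType) (H : nmodType) (fin : dec_finite H).
Hypothesis addI : forall a x y : H, a + x = a + y -> x = y.
Hypothesis conical : forall a b : H, a + b = 0 -> a = 0.
Local Notation Q := (qring R fin).
Variables (J : choiceType).

Definition choices (D : set J) (d : H) : set {fset J * H} :=
  [set s : {fset J * H} | [/\ forall x, x \in s -> D x.1 /\ x.2 != 0,
               {in s &, injective fst} & \sum_(x <- s) x.2 = d]].

Lemma choices_parts D d (s : {fset J * H}) x : choices D d s -> x \in s -> x.2 \in parts d.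
Proof. by move=> [_ _ <-] xs; rewrite (big_fsetD1 x) //=; exact: partsPl. Qed.

Lemma choices_finite (F : seq J) (d : H) : finite_set (choices [set` F] d).
Proof.
pose U := fpowerset ([fset j in F] `*` [fset a in parts d])%fset.
apply: (@sub_finite_set _ _ [set` U]) => // s sF /=.
rewrite fpowersetE; apply/fsubsetP => -[j a] ja.
rewrite in_fsetM !inE; apply/andP; split; first by have [/(_ _ ja)[]] := sF.
exact: choices_parts sF ja.
Qed.

Definition choice_at (j : J) (s : {fset J * H}) : H :=
  \sum_(x <- s) (if x.1 == j then x.2 else 0).

Lemma choice_at0 j (s : {fset J * H}) : (forall x, x \in s -> x.1 <> j) -> choice_at j s = 0.
Proof.
move=> h; rewrite /choice_at big_seq big1 // => x xs.
by have /eqP/negPf-> := h _ xs.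
Qed.

Lemma choice_at_in j (s : {fset J * H}) x :
  {in s &, injective fst} -> x \in s -> x.1 = j -> choice_at j s = x.2.
Proof.
move=> inj xs xj; rewrite /choice_at (big_fsetD1 x) //= xj eqxx.
rewrite big_seq big1 ?addr0 // => y; rewrite !inE => /andP[yx ys].
by case: eqP => // yj; case/eqP: yx; apply: inj => //; rewrite yj.
Qed.

(** A choice on [j :: F] is its exponent [a] at [j] together with a choice on [F]. Exponent 0 is
    encoded by the absence of [j], whence the two cases of the map. *)
Lemma choices_cons_bij (j : J) (F : seq J) (a b : H) : j \notin F ->
  set_bij (choices [set` F] b) (choices [set` j :: F] (a + b) `&` [set s : {fset J * H} | choice_at j s = a])
    (fun s => if a == 0 then s else ((j, a) |` s)%fset).
Proof.
move=> jF.
have jn s : choices [set` F] b s -> forall x, x \in s -> x.1 <> j.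
  by move=> [h _ _] x /h[/= xF _] xj; rewrite xj (negPf jF) in xF.
have jan s : choices [set` F] b s -> (j, a) \notin s.
  by move=> cs; apply/negP => /(jn s cs).
split.
- move=> s cs; have [h1 h2 h3] := cs; split; last first.
    rewrite /=; case: eqP => [->|a0]; first exact: (choice_at0 (jn s cs)).
    rewrite /choice_at big_fsetU1 ?jan //= eqxx -[RHS]addr0; congr (_ + _).
    exact: (choice_at0 (jn s cs)).
  have [->|a0] := eqVneq a 0.
    split=> // [x /h1[/= xF x0]|]; last by rewrite add0r.
    by rewrite inE xF orbT.
  split=> [x|x y|].
  - rewrite !inE => /orP[/eqP-> /=|/h1[/= xF x0]]; split=> //=.
      by rewrite inE eqxx.
    by rewrite inE xF orbT.
  - rewrite !inE => /orP[/eqP->|xs] /orP[/eqP->|ys] //=.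
    + by move=> /esym/(jn s cs y ys).
    + by move=> /(jn s cs x xs).
    exact: h2.
  by rewrite big_fsetU1 ?jan //= h3.
- move=> s t /set_mem cs /set_mem ct /=; case: eqP => // _ st.
  by rewrite -(fsetU1K (jan s cs)) st fsetU1K ?jan.
move=> s [[h1 h2 h3] /= sa]; have [a0|a0] := eqVneq a 0.
  have nj x : x \in s -> x.1 <> j.
    move=> xs xj; have [_] := h1 x xs.
    by rewrite -(choice_at_in h2 xs xj) sa a0 eqxx.
  exists s; last by [].
  split=> //; last by rewrite h3 a0 add0r.
  move=> x xs; have [/= ] := h1 x xs; rewrite inE => /orP[/eqP/(nj x xs) //|-> ->].
  by [].
have [x xs xj] : exists2 x, x \in s & x.1 = j.
  apply: contrapT => hn; case/eqP: a0; rewrite -sa; apply: choice_at0 => x xs xj.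
  by apply: hn; exists x.
have xa : x = (j, a).
  by rewrite -sa (choice_at_in h2 xs xj) -xj; case: (x).
rewrite {}xa in xs {xj}.
exists (s `\ (j, a))%fset; last by rewrite fsetD1K.
split.
- move=> y; rewrite !inE => /andP[yja ys]; have [/= yF y0] := h1 y ys; split=> //.
  move: yF; rewrite inE => /orP[/eqP yj|//]; case/eqP: yja.
  exact: (h2 y (j, a) ys xs yj).
- by move=> y z; rewrite !inE => /andP[_ ys] /andP[_ zs]; exact: h2.
by apply: (@addI a); rewrite -h3 [RHS](big_fsetD1 (j, a)).
Qed.

Lemma qprodE D (f : J -> Q) d :
  qprod D f d = \sum_(s \in choices D d) \prod_(x <- s) f x.1 x.2.
Proof. by []. Qed.

Lemma qprod_cons (f : J -> Q) (j : J) (F : seq J) : j \notin F -> f j 0 = 1 ->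
  (qprod [set` j :: F] f : Q) = f j * qprod [set` F] f.
Proof.
move=> jF fj0; apply: funext => d.
rewrite qprodE fsbig_finite; last exact: choices_finite.
(* The choices are sorted by their exponent at [j]. Those without [j] match the term with [f j 0],
   which is 1. *)
transitivity (\sum_(s <- fset_set (choices [set` j :: F] d))
    \sum_(a <- parts d | choice_at j s == a) \prod_(x <- s) f x.1 x.2).
  rewrite big_seq [RHS]big_seq; apply: eq_bigr => s.
  rewrite in_fset_set; last exact: choices_finite.
  move=> /set_mem cs.
  have sd : choice_at j s \in parts d.
    have [[x xs xj]|nj] := pselect (exists2 x, x \in s & x.1 = j).
      by have [_ inj _] := cs; rewrite (choice_at_in inj xs xj); exact: choices_parts cs xs.
    rewrite choice_at0; first by apply: (@partsPl _ fin _ _ d); rewrite add0r.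
    by move=> x xs xj; apply: nj; exists x.
  rewrite -[RHS]big_filter (_ : [seq a <- parts d | choice_at j s == a] = [:: choice_at j s]).
    by rewrite big_seq1.
  rewrite (@eq_filter _ _ (pred1 (choice_at j s))); last by move=> a /=; rewrite eq_sym.
  exact: filter_pred1_uniq (parts_uniq d) sd.
rewrite (exchange_big_dep xpredT) //= qring_mulE (qmulE fin).
rewrite big_seq [RHS]big_seq; apply: eq_bigr => a ad.
have /(partsP fin)[b abd] := ad.
rewrite (bigD1_seq b) ?parts_uniq ?(partsPr fin abd) //= abd eqxx mulr1n.
rewrite [X in _ + X]big1 ?addr0; last first.
  by move=> c cb; case: eqP => // acd; case/eqP: cb; apply: (@addI a); rewrite abd.
transitivity (\sum_(s \in choices [set` j :: F] (a + b) `&` [set s : {fset J * H} | choice_at j s = a])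
    \prod_(x <- s) f x.1 x.2).
  rewrite (@fsum_seq _ _ _ (fset_set (choices [set` j :: F] d))) ?fset_uniq //; last first.
    by move=> s [cs _] _; rewrite in_fset_set ?abd in cs *; [exact/mem_set|exact: choices_finite].
  rewrite big_seq_cond [RHS]big_seq_cond; apply: eq_bigl => s.
  apply/andb_id2l => sc; rewrite in_fset_set in sc; last exact: choices_finite.
  by rewrite abd; apply/eqP/idP => [sa|/set_mem[]//]; apply/mem_set; split=> //; exact/set_mem.
rewrite (reindex_fsbig _ _ _ _ (choices_cons_bij a b jF)) qprodE.
rewrite fsbig_finite; last exact: choices_finite.
rewrite fsbig_finite; last exact: choices_finite.
rewrite mulr_sumr big_seq [RHS]big_seq.
apply: eq_bigr => s; rewrite in_fset_set; last exact: choices_finite.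
move=> /set_mem[h1 _ _]; case: eqP => [->|a0]; first by rewrite fj0 mul1r.
by rewrite big_fsetU1 //; apply/negP => /h1[/= jF']; rewrite jF' in jF.
Qed.

Lemma qprod_seq (f : J -> Q) (F : seq J) : uniq F -> (forall j, j \in F -> f j 0 = 1) ->
  (qprod [set` F] f : Q) = \prod_(j <- F) f j.
Proof.
elim: F => [|j F IHF] /=.
  move=> _ _; rewrite big_nil; apply: funext => d; rewrite qprodE.
  have nil s : choices [set` [::]] d s -> s = fset0.
    by move=> [h _ _]; apply/fsetP => x; rewrite inE; apply/negP => /h[].
  have [d0|d0] := eqVneq d 0.
    rewrite (_ : choices _ _ = [set fset0]) ?fsbig_set1 ?big_seq_fset0; last first.
      apply/seteqP; split=> [s /nil //|_ ->]; split=> //; by rewrite big_seq_fset0 d0.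
    by rewrite d0 -[RHS]/((0 == 0)%:R) eqxx.
  rewrite fsbig1; first by rewrite -[RHS]/((d == 0)%:R) (negPf d0).
  move=> s cs; case/eqP: d0; have [_ _ <-] := cs.
  by rewrite (nil s cs) big_seq_fset0.
move=> /andP[jF uF] h1; rewrite big_cons -IHF //; last by move=> k kF; rewrite h1 ?inE ?kF ?orbT.
by apply: qprod_cons => //; apply: h1; rewrite inE eqxx.
Qed.

(** The passage from infinite to finite products: a choice with an index outside [F] uses a nonzero
    summand of [d], at which that factor has coefficient 0. *)
Lemma qprod_eqd (D : set J) (f : J -> Q) (F : seq J) (d : H) :
  uniq F -> (forall j, j \in F -> D j /\ f j 0 = 1) ->
  (forall j e, D j -> j \notin F -> e \in parts d -> e != 0 -> f j e = 0) ->
  eqd d (qprod D f) (\prod_(j <- F) f j : Q).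
Proof.
move=> uF hF h e ed; rewrite -qprod_seq //; last by move=> j /hF[].
rewrite !qprodE; apply/esym/fsbig_widen => [s [h1 h2 h3]|s [[h1 h2 h3] h4]] /=.
  by split=> // x /h1[/= xF x0]; split=> //; have [] := hF _ xF.
have cs : choices D e s by split.
have [x xs xF] : exists2 x, x \in s & x.1 \notin F.
  apply: contrapT => hn; apply: h4; split=> // x xs; split; last by have [] := h1 x xs.
  by apply: contrapT => /negP xF; apply: hn; exists x.
have [Dx x0] := h1 x xs.
rewrite (big_fsetD1 x) //= h ?mul0r //.
exact: parts_trans (choices_parts cs xs) ed.
Qed.

Lemma eq_qprod (D : set J) (f g : J -> Q) : (forall j, D j -> f j = g j) ->
  qprod D f = qprod D g.
Proof.
move=> fg; apply: funext => d; rewrite !qprodE; apply: eq_fsbigr => s /set_mem[h _ _].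
by rewrite big_seq [RHS]big_seq; apply: eq_bigr => x /h[/fg -> _].
Qed.

End Products.

(** * Rogers-Ramanujan identities for power q-sums *)

Lemma mulr_cancel_mid (A : comNzRingType) (x y p v : A) : p * v = 1 -> x * v * (p * y) = x * y.
Proof. by move=> pv; rewrite -mulrA [v * _]mulrA [v * p]mulrC pv mul1r. Qed.

Section RogersRamanujanSums.
Variables (R : comNzRingType) (H : nmodType) (fin : dec_finite H).
Hypothesis addI : forall a x y : H, a + x = a + y -> x = y.
Hypothesis conical : forall a b : H, a + b = 0 -> a = 0.
Local Notation Q := (qring R fin).

Lemma qmul_at0 (f g : Q) : (f * g) 0 = f 0 * g 0.
Proof.
have z0 a : a \in parts 0 -> a = 0 :> H by move=> /(partsP fin)[b /conical].
rewrite qring_mulE (qmulE fin) (bigD1_seq 0) ?parts_uniq ?parts_self //=.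
rewrite (bigD1_seq 0) ?parts_uniq ?parts_self //= addr0 eqxx mulr1n.
rewrite big1_seq ?addr0; last by move=> b /andP[b0 /z0 b0']; rewrite b0' eqxx in b0.
by rewrite big1_seq ?addr0 // => b /andP[b0 /z0 b0']; rewrite b0' eqxx in b0.
Qed.

Lemma qgeom_at0 (a : H) : a != 0 -> qgeom R a 0 = 1.
Proof. by move=> a0; rewrite (qgeomE R addI conical) //; case: asboolP => // -[]; exists 0%N. Qed.

Lemma natmul_neq0 (a : H) n : a != 0 -> (0 < n)%N -> a *+ n != 0.
Proof. by case: n => // n a0 _; apply: contra a0 => /eqP/(natmul_eq0 conical)->. Qed.

Variables (a : H) (a0 : a != 0).
Local Notation X := (qexp R a : Q).

Lemma qgeom_invX n : (0 < n)%N -> (1 - X ^+ n) * (qgeom R (a *+ n) : Q) = 1.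
Proof. by move=> n0; rewrite -(qexpMn R fin addI) (qgeom_inv R fin addI conical) ?natmul_neq0. Qed.

Lemma qpochE n : qpoch R a n = (poch X 0 n : Q).
Proof.
rewrite /qpoch /poch big_add1 /=; apply: (eq_bigr (fun k => 1 - X ^+ k.+1 : Q)) => k _.
by rewrite -(qexpMn R fin addI).
Qed.

Lemma poch_unit n : exists I : Q, poch X 0 n * I = 1.
Proof.
exists (\prod_(0 <= k < n) (qgeom R (a *+ k.+1) : Q)).
by rewrite /poch -big_split big1 //= => k _; exact: qgeom_invX.
Qed.

Lemma qinv_poch n : poch X 0 n * (qinv (qpoch R a n) : Q) = 1.
Proof. by rewrite qpochE; have [I PI] := poch_unit n; rewrite (qinv_eq PI). Qed.

Variables (d : H) (N : nat).
Hypothesis a_bound : forall n, a *+ n \in parts d -> (n < N)%N.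

Lemma a_notin_parts n : (N <= n)%N -> a *+ n \notin parts d.
Proof. by move=> Nn; apply/negP => /a_bound; rewrite ltnNge Nn. Qed.

Lemma RR_prod_eqd i j : (0 < i)%N -> (0 < j)%N ->
  eqd d (RR_prod R i j a)
    (\prod_(n <- iota 0 N) ((qgeom R (a *+ (5 * n + i)) : Q) * qgeom R (a *+ (5 * n + j))) : Q).
Proof.
move=> i0 j0; rewrite /RR_prod.
have nz n k : (0 < k)%N -> a *+ (5 * n + k) != 0.
  by move=> k0; rewrite natmul_neq0 // addn_gt0 k0 orbT.
have qinvE n : qinv (qmul (qsub (@qone R H) (qexp R (a *+ (5 * n + i))))
                          (qsub (@qone R H) (qexp R (a *+ (5 * n + j))))) =
   ((qgeom R (a *+ (5 * n + i)) : Q) * qgeom R (a *+ (5 * n + j)) : Q).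
  apply: qinv_eq.
  rewrite -[qmul _ _]/((1 - (qexp R (a *+ (5 * n + i)) : Q)) * (1 - (qexp R (a *+ (5 * n + j)) : Q))).
  by rewrite mulrACA !(qgeom_inv R fin addI conical) ?nz // mulr1.
rewrite (_ : (fun n => _) = (fun n => (qgeom R (a *+ (5 * n + i)) : Q) * qgeom R (a *+ (5 * n + j)))).
  apply: (qprod_eqd addI (iota_uniq _ _)) => [n _|n e _ nN ed e0].
    by split=> //; rewrite qmul_at0 !qgeom_at0 ?nz // mulr1.
  have {}nN : (N <= n)%N by move: nN; rewrite mem_iota /= add0n -leqNgt.
  have h : eqd d ((qgeom R (a *+ (5 * n + i)) : Q) * qgeom R (a *+ (5 * n + j)) : Q) (1 * 1 : Q).
    by apply: eqdM; apply: (qgeom_eqd1 R fin addI conical); rewrite ?nz // a_notin_parts //; lia.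
  by rewrite h // mulr1 -[LHS]/((e == 0)%:R) (negPf e0).
by apply: funext => n; rewrite qinvE.
Qed.

Definition RR_sum e : Q := qseries (fun n => qmul (qexp R (a *+ (n * (n + e)))) (qinv (qpoch R a n))).

Lemma RR_sum_eqd e : eqd d (RR_sum e)
  (\sum_(n <- iota 0 N) (X ^+ (n * (n + e)) * (qinv (qpoch R a n) : Q)) : Q).
Proof.
move=> x xd; rewrite /RR_sum /qseries (@fsum_seq _ _ _ (iota 0 N)) ?iota_uniq //; last first.
  move=> n _; apply: contraR; rewrite mem_iota /= add0n -leqNgt => Nn; apply/eqP.
  have h := @eqd_exp0 R _ fin d (a *+ (n * (n + e))) (qinv (qpoch R a n)).
  by apply: h => //; apply: a_notin_parts; nia.
under eq_bigl do rewrite in_setT.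
elim: (iota 0 N) => [|n s IHs]; first by rewrite !big_nil.
rewrite !big_cons IHs; congr (_ + _).
by rewrite -(qexpMn R fin addI).
Qed.

(** With $P=(q^a)_N$ and [W] the inverse of the truncated product, the sum times $P$ is $S$, and
    $S=S\cdot W\cdot\prod=P\cdot\prod$ below [d]; then $P$ is cancelled. *)
Lemma RR_sum_prod_eqd e : (e <= 1)%N -> eqd d (RR_sum e) (RR_prod R (1 + e) (4 - e) a).
Proof.
move=> e1.
have N0 : (0 < N)%N by apply: (a_bound (n := 0)); apply: (@partsPl _ fin _ _ d); rewrite mulr0n add0r.
pose S : Q := \sum_(s < N.+1) X ^+ (s * (s + e)) * poch X s N.
pose W : Q := \prod_(j < N) ((1 - X ^+ (5 * j + (1 + e))) * (1 - X ^+ (5 * j + (4 - e)))).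
pose P := poch X 0 N.
have SW : eqd d (S * W : Q) P.
  have [c ->] := truncated_rogers_ramanujan X e1 N0.
  rewrite -[X in eqd d _ X]addr0; apply: eqdD; first exact: eqd_refl.
  by rewrite -(qexpMn R fin addI); apply: eqd_exp0; apply: a_notin_parts.
have sumP : eqd d (RR_sum e * P : Q) S.
  apply: eqd_trans (eqdM (@RR_sum_eqd e) (@eqd_refl _ _ fin d P)) _.
  rewrite mulr_suml /S -(big_mkord xpredT (fun s => X ^+ (s * (s + e)) * poch X s N)).
  rewrite big_nat_recr //= -[X in eqd d X]addr0; apply: eqdD.
    rewrite /index_iota subn0; apply: eqd_sum => n; rewrite mem_iota add0n => /andP[_ nN].
    have -> : P = poch X 0 n * poch X n N by apply/esym/poch_cat; exact: ltnW.
    rewrite (mulr_cancel_mid _ _ (qinv_poch n)); exact: eqd_refl.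
  (* The term $s=N$, present only in [S], lies beyond [d]. *)
  by apply: eqd_sym; rewrite -(qexpMn R fin addI); apply: eqd_exp0; apply: a_notin_parts; nia.
have prodW : eqd d ((RR_prod R (1 + e) (4 - e) a : Q) * W : Q) 1.
  apply: eqd_trans (eqdM (@RR_prod_eqd (1 + e) (4 - e) _ _) (@eqd_refl _ _ fin d W)) _; [by []|lia|].
  rewrite /W -(big_mkord xpredT (fun j => (1 - X ^+ (5 * j + (1 + e))) * (1 - X ^+ (5 * j + (4 - e))))).
  rewrite /index_iota subn0 -big_split big1 //= => n _.
  by rewrite mulrACA ![(qgeom _ _ : Q) * _]mulrC !qgeom_invX ?mulr1 //; lia.
have [I PI] := poch_unit N.
have h : eqd d (RR_sum e * P : Q) ((RR_prod R (1 + e) (4 - e) a : Q) * P : Q).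
  apply: (eqd_trans sumP); rewrite -[S in eqd d S]mulr1.
  apply: (eqd_trans (eqdM (@eqd_refl _ _ fin d S) (eqd_sym prodW))).
  by rewrite mulrCA; apply: eqdM SW; exact: eqd_refl.
have := eqdM h (@eqd_refl _ _ fin d I).
by rewrite -!mulrA PI !mulr1.
Qed.

End RogersRamanujanSums.

Section RogersRamanujan.
Variables (R : comNzRingType) (H : nmodType) (fin : dec_finite H).
Hypothesis addI : forall a x y : H, a + x = a + y -> x = y.
Hypothesis conical : forall a b : H, a + b = 0 -> a = 0.

Lemma RR_sum_prod (a : H) e : a != 0 -> (e <= 1)%N ->
  RR_sum R fin a e = RR_prod R (1 + e) (4 - e) a.
Proof.
move=> a0 e1; apply: (@eqd_eq R H fin) => d.
have [N hN] := natmul_parts_bounded fin addI conical d.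
apply: (@RR_sum_prod_eqd R H fin addI conical a a0 d N.+1) => // n and_.
by rewrite ltnS; exact: hN and_.
Qed.

Lemma rogers_ramanujan1 (a : H) : a != 0 -> RR1_sum R a = RR_prod R 1 4 a.
Proof.
move=> a0; rewrite -(RR_sum_prod (e := 0)) // /RR1_sum /RR_sum.
by congr qseries; apply: funext => n; rewrite addn0 mulnn.
Qed.

Lemma rogers_ramanujan2 (a : H) : a != 0 -> RR2_sum R a = RR_prod R 2 3 a.
Proof.
move=> a0; rewrite -(RR_sum_prod (e := 1)) // /RR2_sum /RR_sum.
by congr qseries; apply: funext => n; rewrite addn1.
Qed.

End RogersRamanujan.

(** * Sorting factors by primitive part *)

Section Dissection.
Variables (R : comNzRingType) (H : nmodType) (fin : dec_finite H).
Hypothesis addI : forall a x y : H, a + x = a + y -> x = y.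
Hypothesis conical : forall a b : H, a + b = 0 -> a = 0.
Local Notation Q := (qring R fin).

Lemma natmul_partsl (a : H) n d : (0 < n)%N -> a *+ n \in parts d -> a \in parts d.
Proof.
case: n => // n _; apply: (parts_trans fin).
by apply: (@partsPl _ fin _ _ (a *+ n)); rewrite mulrS.
Qed.

(** No positive multiple of [a] is a summand of [d], so the bound $N=1$ applies and only the factor
    $n=0$ is left. *)
Lemma RR_prod_eqd1 (a d : H) i j : a != 0 -> (0 < i)%N -> (0 < j)%N -> a \notin parts d ->
  eqd d (RR_prod R i j a : Q) 1.
Proof.
move=> a0 i0 j0 ad.
have notin n : (0 < n)%N -> a *+ n \notin parts d.
  by move=> n0; apply: contra ad; exact: natmul_partsl.
have bnd n : a *+ n \in parts d -> (n < 1)%N.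
  by case: n => // n /(negP (notin n.+1 isT)).
apply: (eqd_trans (RR_prod_eqd R fin addI conical a0 bnd i0 j0)).
rewrite big_seq1 muln0 !add0n -[1](mulr1 (1 : Q)).
by apply: eqdM; apply: (qgeom_eqd1 R fin addI conical); rewrite ?natmul_neq0 ?notin.
Qed.

Lemma qprod_RR_prod_eqd (X : set H) (d : H) N i j : (0 < i)%N -> (0 < j)%N ->
  (forall a, X a -> a != 0) -> (forall a n, a != 0 -> a *+ n \in parts d -> (n < N)%N) ->
  eqd d (qprod X (fun a => RR_prod R i j a : Q))
    (\prod_(a <- [seq a <- parts d | a \in X])
      \prod_(m <- [seq (5 * n + r)%N | n <- iota 0 N, r <- [:: i; j]])
        (qgeom R (a *+ m) : Q) : Q).
Proof.
move=> i0 j0 X0 bnd.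
set F := [seq a <- parts d | a \in X].
have FX a : a \in F -> X a by rewrite mem_filter => /andP[/set_mem].
apply: (@eqd_trans _ _ fin _ _ (\prod_(a <- F) (RR_prod R i j a : Q))).
  apply: (qprod_eqd addI) => [|a aF|a e Xa aF ed e0].
  - exact: filter_uniq (parts_uniq d).
  - split; first exact: FX.
    have a0 := X0 _ (FX _ aF).
    have ap : a \notin parts 0 by apply: contra a0 => /(partsP fin)[b /conical ->].
    by rewrite (RR_prod_eqd1 a0 i0 j0 ap (parts_self fin 0)) -[LHS]/((0 == 0)%:R) eqxx.
  have ad : a \notin parts d by apply: contra aF => ad; rewrite mem_filter ad andbT; exact/mem_set.
  by rewrite (RR_prod_eqd1 (X0 _ Xa) i0 j0 ad ed) -[LHS]/((e == 0)%:R) (negPf e0).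
apply: eqd_prod => a /FX/X0 a0.
apply: (eqd_trans (RR_prod_eqd R fin addI conical a0 (fun n => @bnd a n a0) i0 j0)).
rewrite big_allpairs_dep; apply: eqd_prod => n _.
by rewrite big_cons big_seq1; exact: eqd_refl.
Qed.

Variables (prim : set H).
Hypothesis prim_neq0 : forall a, prim a -> a != 0.
Hypothesis prim_exists : forall d, d != 0 -> exists a n, [/\ prim a, (0 < n)%N & d = a *+ n].
Hypothesis prim_unique : forall a b m n, prim a -> prim b -> (0 < m)%N -> (0 < n)%N ->
  a *+ m = b *+ n -> a = b /\ m = n.

Lemma multiples_uniq (X : set H) (s : seq H) N i j : X `<=` prim ->
  (0 < i < 5)%N -> (0 < j < 5)%N -> i != j -> uniq s -> (forall a, a \in s -> X a) ->
  uniq [seq a *+ m | a <- s, m <- [seq (5 * n + r)%N | n <- iota 0 N, r <- [:: i; j]]].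
Proof.
move=> Xp i5 j5 ij us sX; apply: allpairs_uniq => //.
  apply: allpairs_uniq; [exact: iota_uniq|by rewrite /= inE ij|].
  move=> u v /allpairsP[p [_ pij ->]] /allpairsP[p' [_ pij' ->]] /=.
  move: pij pij'; case: p => n r; case: p' => n' r' /=.
  rewrite !inE => /orP[]/eqP-> /orP[]/eqP-> e; congr (_, _); lia.
move=> u v /allpairsP[[x y] [xs ym ->]] /allpairsP[[x' y'] [xs' ym' ->]] /= e.
move: xs ym xs' ym' => /= xs ym xs' ym'.
have pos z : z \in [seq (5 * n + r)%N | n <- iota 0 N, r <- [:: i; j]] -> (0 < z)%N.
  by move=> /allpairsP[[k r] /= [_ rij ->]]; move: rij; rewrite !inE => /orP[]/eqP->; lia.
have [-> ->] // := prim_unique (Xp _ (sX _ xs)) (Xp _ (sX _ xs')) (pos _ ym) (pos _ ym') e.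
Qed.

(** Below [d] each side is a product of geometric series over a finite list of exponents. Existence
    and uniqueness of the primitive part make the two lists permutations of each other. *)
Lemma qprod_dissect (D X Y : set H) i j k l :
  [/\ (0 < i < 5)%N, (0 < j < 5)%N & i != j] -> [/\ (0 < k < 5)%N, (0 < l < 5)%N & k != l] ->
  X `<=` prim -> Y `<=` prim -> X `&` Y `<=` set0 -> (forall d, D d -> d != 0) ->
  (forall a m, prim a -> (0 < m)%N ->
     D (a *+ m) <-> (X a /\ (m %% 5)%N \in [:: i; j]) \/ (Y a /\ (m %% 5)%N \in [:: k; l])) ->
  qprod D (@qgeom R H) = qmul (qprod X (@RR_prod R H i j)) (qprod Y (@RR_prod R H k l)).
Proof.
move=> [i5 j5 ij] [k5 l5 kl] Xp Yp XY D0 DXY.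
apply: (@eqd_eq R H fin) => d.
have [N hN] : exists N, forall (a : H) n, a != 0 -> a *+ n \in parts d -> (n < N)%N.
  by have [N hN] := natmul_parts_bounded fin addI conical d; exists N.+1.
have [i0 j0 k0 l0] : [/\ (0 < i)%N, (0 < j)%N, (0 < k)%N & (0 < l)%N] by split; lia.
have X0 a : X a -> a != 0 by move=> /Xp/prim_neq0.
have Y0 a : Y a -> a != 0 by move=> /Yp/prim_neq0.
have hX := qprod_RR_prod_eqd i0 j0 X0 hN.
have hY := qprod_RR_prod_eqd k0 l0 Y0 hN.
apply: eqd_trans (eqd_sym (eqdM hX hY)).
set FX := [seq a <- parts d | a \in X]; set FY := [seq a <- parts d | a \in Y].
set MX := [seq (5 * n + r)%N | n <- iota 0 N, r <- [:: i; j]].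
set MY := [seq (5 * n + r)%N | n <- iota 0 N, r <- [:: k; l]].
pose FD := [seq a <- parts d | a \in D].
apply: (@eqd_trans _ _ fin _ _ (\prod_(a <- FD) (qgeom R a : Q))).
  apply: (qprod_eqd addI) => [|a|a e Da aF ed e0].
  - exact: filter_uniq (parts_uniq d).
  - rewrite mem_filter => /andP[/set_mem Da _]; split=> //.
    by rewrite (qgeom_at0 _ addI conical) // D0.
  have ad : a \notin parts d by apply: contra aF => ad; rewrite mem_filter ad andbT; exact/mem_set.
  rewrite (qgeom_eqd1 R fin addI conical _ ad ed) ?D0 //.
  by rewrite -[LHS]/((e == 0)%:R) (negPf e0).
pose L := [seq a *+ m | a <- FX, m <- MX] ++ [seq a *+ m | a <- FY, m <- MY].
rewrite (_ : _ * _ = \prod_(a <- L) (qgeom R a : Q)); last by rewrite /L big_cat !big_allpairs_dep.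
have memM r s z : (0 < r < 5)%N -> (0 < s < 5)%N ->
    (z \in [seq (5 * n + r)%N | n <- iota 0 N, r <- [:: r; s]]) =
    [&& (z %/ 5 < N)%N & (z %% 5)%N \in [:: r; s]].
  move=> r5 s5; apply/allpairsP/andP => [[[n t] /= [nN trs ->]]|[zN zrs]].
    move: nN trs; rewrite mem_iota !inE /= add0n => nN /orP[]/eqP->.
      by split; [lia|apply/orP; left; apply/eqP; lia].
    by split; [lia|apply/orP; right; apply/eqP; lia].
  by exists (z %/ 5, z %% 5)%N; split=> //=; [rewrite mem_iota|lia].
have L0 a : a \in L -> a != 0.
  have pos r s z : (0 < r < 5)%N -> (0 < s < 5)%N ->
      z \in [seq (5 * n + r)%N | n <- iota 0 N, r <- [:: r; s]] -> (0 < z)%N.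
    by move=> r5 s5; rewrite memM // !inE => /andP[_ /orP[]/eqP zr]; lia.
  rewrite mem_cat => /orP[] /allpairsP[[b m] /= [bF mM ->]];
    apply: (natmul_neq0 conical) (pos _ _ _ _ _ mM) => //.
    by move: bF; rewrite mem_filter => /andP[/set_mem/X0].
  by move: bF; rewrite mem_filter => /andP[/set_mem/Y0].
(* [L] may contain exponents that are not summands of [d]; their factors are 1 below [d] and are
   dropped. *)
apply: (@eqd_trans _ _ fin _ _ (\prod_(a <- L) (if a \in parts d then qgeom R a : Q else 1))); last first.
  apply: eqd_prod => a aL; case: ifPn => // ad.
  by apply: eqd_sym; apply: (qgeom_eqd1 R fin addI conical); rewrite ?L0.
rewrite -big_mkcond -[X in eqd d _ X]big_filter.
suff pe : perm_eq FD [seq a <- L | a \in parts d] by rewrite (perm_big _ pe); exact: eqd_refl.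
have uL : uniq L.
  rewrite cat_uniq; apply/and3P; split.
  - apply: (@multiples_uniq X FX N i j Xp i5 j5 ij (filter_uniq _ (parts_uniq d))).
    by move=> a; rewrite mem_filter => /andP[/set_mem].
  - apply/hasPn => z /allpairsP[[b m] /= [bF mM ->]]; apply/negP => /allpairsP[[a n] /= [aF nM e]].
    move: bF aF; rewrite !mem_filter => /andP[/set_mem Yb _] /andP[/set_mem Xa _].
    have mpos : (0 < m)%N by move: mM; rewrite memM // !inE => /andP[_ /orP[]/eqP zr]; lia.
    have npos : (0 < n)%N by move: nM; rewrite memM // !inE => /andP[_ /orP[]/eqP zr]; lia.
    have [ba _] := prim_unique (Yp _ Yb) (Xp _ Xa) mpos npos e.
    by apply: (XY a); split=> //; rewrite -ba.
  apply: (@multiples_uniq Y FY N k l Yp k5 l5 kl (filter_uniq _ (parts_uniq d))).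
  by move=> a; rewrite mem_filter => /andP[/set_mem].
apply: uniq_perm; [exact: filter_uniq (parts_uniq d)|exact: filter_uniq|].
move=> z; rewrite !mem_filter andbC; apply: andb_id2l => zd.
apply/idP/idP => [/set_mem Dz|].
  have [a [m [pa m0 zam]]] := prim_exists (D0 _ Dz).
  have ad : a \in parts d by apply: (natmul_partsl m0); rewrite -zam.
  have mN : (m < N)%N by apply: (hN a); rewrite ?prim_neq0 // -zam.
  move: Dz; rewrite zam => /(DXY a m pa m0) [[Xa mij]|[Ya mkl]]; rewrite mem_cat; apply/orP.
    left; apply/allpairsP; exists (a, m); split=> //=; first by rewrite mem_filter ad andbT; exact/mem_set.
    by rewrite memM // mij andbT; lia.
  right; apply/allpairsP; exists (a, m); split=> //=; first by rewrite mem_filter ad andbT; exact/mem_set.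
  by rewrite memM // mkl andbT; lia.
rewrite mem_cat => /orP[] /allpairsP[[a m] /= [aF mM ->]]; apply/mem_set;
  move: aF mM; rewrite mem_filter memM // => /andP[/set_mem Fa _] /andP[_ mr];
  have m0 : (0 < m)%N by (move: mr; rewrite !inE => /orP[]/eqP zr; lia).
  by apply/(DXY _ _ (Xp _ Fa) m0); left.
by apply/(DXY _ _ (Yp _ Fa) m0); right.
Qed.

End Dissection.

(** * Embeddings of a number field *)

Lemma exists_rmorphism (A B : nzRingType) (f : A -> B) :
  {morph f : x y / x - y} -> {morph f : x y / x * y} -> f 1 = 1 ->
  exists g : {rmorphism A -> B}, g =1 f.
Proof.
move=> fB fM f1.
pose fa := GRing.isZmodMorphism.Build A B f fB.
pose fm := GRing.isMonoidMorphism.Build A B f (f1, fM).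
by exists (HB.pack_for {rmorphism A -> B} f fa fm).
Qed.

Section RegularRepresentation.
Variables (K : fieldExtType rat).
Local Notation n := (\dim {:K}).
Local Notation b := (vbasis {:K}).

Definition coordv (x : K) : 'rV[rat]_n := \row_j coord b j x.
Definition multmx (x : K) : 'M[rat]_n := \matrix_(i, j) coord b j (b`_i * x).

Lemma coordvM x y : coordv (x * y) = coordv x *m multmx y.
Proof.
apply/rowP => j; rewrite !mxE {1}(coord_vbasis (memvf x)) mulr_suml linear_sum.
by apply: eq_bigr => i _; rewrite !mxE -scalerAl linearZ.
Qed.

Lemma multmxM x y : multmx (x * y) = multmx x *m multmx y.
Proof.
apply/row_matrixP => i; rewrite row_mul.
have rowE z : row i (multmx z) = coordv (b`_i * z) by apply/rowP => j; rewrite !mxE.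
by rewrite !rowE mulrA coordvM.
Qed.

Lemma multmxB x y : multmx (x - y) = multmx x - multmx y.
Proof. by apply/matrixP => i j; rewrite !mxE mulrBr linearB. Qed.

Lemma multmx1 : multmx 1 = 1%:M.
Proof.
by apply/matrixP => i j; rewrite !mxE mulr1 coord_free ?(basis_free (vbasisP _)).
Qed.

Lemma multmx_sum x : multmx x = \sum_k coord b k x *: multmx b`_k.
Proof.
apply/matrixP => i j; rewrite {1}(coord_vbasis (memvf x)) summxE mxE mulr_sumr linear_sum.
by apply: eq_bigr => k _; rewrite !mxE -scalerAr linearZ.
Qed.

Lemma dim_pos : (0 < n)%N.
Proof. by rewrite adim_gt0. Qed.

End RegularRepresentation.

Section Embeddings.
Variables (K : fieldExtType rat) (C : numClosedFieldType).
Local Notation n := (\dim {:K}).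

(** The matrices of a basis commute, so one change of basis makes them triangular, and by linearity
    all of them. Each diagonal entry is then multiplicative, hence an embedding. *)
Lemma embeddings_diag :
  exists s : 'I_n -> {rmorphism K -> C}, forall x,
    map_poly ratr (char_poly (multmx x)) = \prod_(i < n) ('X - (s i x)%:P).
Proof.
pose A x : 'M[C]_n := map_mx ratr (multmx x).
have AM x y : A (x * y) = A x *m A y by rewrite /A multmxM map_mxM.
have AC x y : A x *m A y = A y *m A x by rewrite -!AM mulrC.
have [|P Pu /allP Pt] := @cotrigonalization C n [seq A (vbasis {:K})`_k | k : 'I_n <- enum 'I_n].
  by move=> _ _ /mapP[k _ ->] /mapP[l _ ->]; exact: AC.
have {}Pu := unitarymx_unit Pu.
pose T x := P *m A x *m invmx P.
have TM x y : T (x * y) = T x *m T y.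
  by rewrite /T AM !mulmxA mulmxKV.
have TB x y : T (x - y) = T x - T y.
  by rewrite /T /A multmxB map_mxB mulmxBr mulmxBl.
have T1 : T 1 = 1%:M by rewrite /T /A multmx1 map_mx1 mulmx1 mulmxV.
have Tt x : is_trig_mx (T x).
  apply/is_trig_mxP => i j ij; rewrite /T /A multmx_sum.
  rewrite rmorph_sum mulmx_sumr mulmx_suml summxE big1 // => k _.
  have /Pt : A (vbasis {:K})`_k \in [seq A (vbasis {:K})`_k | k : 'I_n <- enum 'I_n].
    by apply/mapP; exists k; rewrite ?mem_enum.
  rewrite /= /mxred.similar_to mxred.conjumx // => /is_trig_mxP/(_ i j ij) h.
  by rewrite map_mxZ -scalemxAr -scalemxAl mxE h mulr0.
have sE (i : 'I_n) : exists g : {rmorphism K -> C}, g =1 (fun x => T x i i).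
  apply: exists_rmorphism => [x y|x y|].
  - by rewrite TB !mxE.
  - rewrite TM mxE (bigD1 i) //= big1 ?addr0 // => j ji.
    have [ij|ij] := ltnP i j; first by rewrite (is_trig_mxP (Tt x)) // mul0r.
    by rewrite (is_trig_mxP (Tt y)) ?mulr0 // ltn_neqAle ij andbT.
  - by rewrite T1 mxE eqxx.
have [s hs] := choice sE; exists s => x.
rewrite map_char_poly -[map_mx _ _]/(A x).
have -> : char_poly (A x) = char_poly (T x).
  have PI : map_mx (@polyC C) P *m map_mx polyC (invmx P) = 1%:M by rewrite -map_mxM mulmxV // map_mx1.
  have E : char_poly_mx (T x) = map_mx polyC P *m char_poly_mx (A x) *m map_mx polyC (invmx P).
    rewrite /char_poly_mx mulmxBr mulmxBl -!map_mxM; congr (_ - _).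
    by rewrite scalar_mxC -mulmxA PI mulmx1.
  by rewrite /char_poly E !det_mulmx mulrAC -det_mulmx PI det1 mul1r.
rewrite char_poly_trig //; by apply: eq_bigr => i _; rewrite hs.
Qed.

End Embeddings.

(** * Finiteness of integers with bounded conjugates *)

Lemma finite_roots (F : fieldType) (p : {poly F}) : p != 0 -> finite_set [set x | root p x].
Proof.
have [m pm] := ubnP (size p); elim: m p pm => // m IHm p pm p0.
have [[x px]|nr] := pselect (exists x, root p x); last first.
  by rewrite (_ : [set _ | _] = set0) //; apply/seteqP; split=> // x px; apply: nr; exists x.
have [q pq] := factor_theorem p x px.
have q0 : q != 0 by apply: contraNneq p0 => q0; rewrite pq q0 mul0r.
have qm : (size q < m)%N.
  by move: pm; rewrite pq size_mul ?polyXsubC_eq0 // size_XsubC addn2 ltnS.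
apply: (@sub_finite_set _ _ ([set x] `|` [set y | root q y])); last first.
  by rewrite finite_setU; split; [exact: finite_set1|exact: IHm].
by move=> y /=; rewrite pq rootM root_XsubC => /orP[|/eqP]; [right|left].
Qed.

(** Multiplying by $X-z$ enlarges the coefficient bound by a factor of at most $1+|z|$. *)
Lemma coef_prod_XsubC_bound (F : numDomainType) (s : seq F) (B : F) (i : nat) :
  (forall z, z \in s -> `|z| <= B) -> 0 <= B ->
  `|(\prod_(z <- s) ('X - z%:P))`_i| <= (1 + B) ^+ size s.
Proof.
move=> + B0; elim: s i => [|z s IHs] i hs.
  by rewrite big_nil coef1 expr0; case: eqP; rewrite ?normr1 ?normr0 ?ler01.
have {}IHs j : `|(\prod_(z <- s) ('X - z%:P))`_j| <= (1 + B) ^+ size s.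
  by apply: IHs => w ws; apply: hs; rewrite inE ws orbT.
rewrite big_cons mulrBl coefB coefXM coefCM /= exprS mulrDl mul1r.
apply: (le_trans (ler_normB _ _)); apply: lerD.
  by case: eqP => // _; rewrite normr0 exprn_ge0 // addr_ge0 ?ler01.
by rewrite normrM ler_pM // hs // inE eqxx.
Qed.

Section IntegralPolynomials.
Variable K : fieldExtType rat.
Local Notation n := (\dim {:K}).
Local Notation pZtoQ := (map_poly (intr : int -> rat)).

Lemma root_char_poly_multmx (x : K) : root (map_poly (in_alg K) (char_poly (multmx x))) x.
Proof.
rewrite map_char_poly; set A := map_mx _ _.
have -> : char_poly A = char_poly A^T.
  by rewrite /char_poly -[in LHS]det_tr /char_poly_mx linearB /= tr_scalar_mx map_trmx.
rewrite -eigenvalue_root_char; apply/eigenvalueP.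
(* The basis itself, as a row vector over [K], is an eigenvector of the transpose with eigenvalue
   [x]. *)
exists (\row_j (vbasis {:K})`_j).
  apply/rowP => i; rewrite !mxE [RHS]mulrC [RHS](coord_vbasis (memvf _)).
  by apply: eq_bigr => j _; rewrite !mxE [LHS]mulrC mulr_algl.
apply/eqP => /rowP/(_ (Ordinal (dim_pos K))); rewrite !mxE /= => b0.
have := basis_mem (vbasisP {:K}); have := basis_free (vbasisP {:K}).
have nb : ((vbasis {:K})`_0 \in vbasis {:K}) by apply: mem_nth; rewrite size_tuple dim_pos.
by move=> /free_not0/(_ nb); rewrite b0 eqxx.
Qed.

Lemma in_alg_pZtoQ (p : {poly int}) : map_poly (in_alg K) (pZtoQ p) = map_poly intr p.
Proof. by rewrite -map_poly_comp; apply: eq_map_poly => z; exact: (rmorph_int (in_alg K)). Qed.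

(** A monic integer polynomial killing [x] may have foreign roots, and the characteristic polynomial
    is only known to be rational; their gcd is integral and all its roots are conjugates of [x]. *)
Lemma integral_conj_poly (x : K) : integralOver (intr : int -> K) x ->
  exists p : {poly int}, [/\ p \is monic, root (map_poly intr p) x &
    pZtoQ p %| char_poly (multmx x)].
Proof.
move=> [P Pm Px]; pose g := gcdp (pZtoQ P) (char_poly (multmx x)).
have gx : root (map_poly (in_alg K) g) x.
  by rewrite gcdp_map root_gcd in_alg_pZtoQ Px root_char_poly_multmx.
(* Gauss: up to a scalar, a factor of a monic integer polynomial is monic and integral. *)
have [p1 [a a0 ga] [r Pr]] := dvdpP_rat_int (dvdp_gcdl (pZtoQ P) (char_poly (multmx x))).
have lead1 : lead_coef p1 * lead_coef r = 1 by rewrite -lead_coefM -Pr; exact/eqP.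
have lead2 : lead_coef p1 * lead_coef p1 = 1.
  have : lead_coef p1 \is a GRing.unit by apply/unitrP; exists (lead_coef r); rewrite mulrC.
  by case/orP => /eqP->.
have l0 : (lead_coef p1)%:~R != 0 :> rat.
  by rewrite intr_eq0; apply/eqP => l0; move: lead2; rewrite l0 mul0r.
have gE : g = (a * (lead_coef p1)%:~R) *: pZtoQ (lead_coef p1 *: p1).
  rewrite map_polyZ scalerA -mulrA -[(_)%:~R * _]rmorphM lead2 mulr1; exact: ga.
exists (lead_coef p1 *: p1); split.
- by rewrite monicE lead_coefZ lead2.
- rewrite -in_alg_pZtoQ; move: gx; rewrite gE map_polyZ /= rootZ //.
  by rewrite scaler_eq0 oner_eq0 orbF mulf_neq0.
have := dvdp_gcdr (pZtoQ P) (char_poly (multmx x)); rewrite -/g gE dvdpZl //.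
by rewrite mulf_neq0.
Qed.

Variable C : numClosedFieldType.

Lemma root_embedding (x : K) (z : C) :
  root (map_poly ratr (char_poly (multmx x))) z -> exists s : {rmorphism K -> C}, z = s x.
Proof.
have [s hs] := embeddings_diag K C; rewrite hs /root horner_prod prodf_seq_eq0 => /hasP[i _].
by rewrite /= hornerXsubC subr_eq0 => /eqP ->; exists (s i).
Qed.

Lemma exists_embedding : exists s : {rmorphism K -> C}, True.
Proof. by have [s _] := embeddings_diag K C; exists (s (Ordinal (dim_pos K))). Qed.

Lemma bounded_integers_finite (k : nat) :
  finite_set [set x : K | integralOver (intr : int -> K) x /\
                         forall s : {rmorphism K -> C}, `|s x| <= k%:R].
Proof.
pose M := ((1 + k) ^ n)%N.
(* The finitely many polynomials of degree at most [n] with coefficients in $[-M,M]$, shifted by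
   $M$; [M] is the bound of [coef_prod_XsubC_bound]. *)
pose q (f : {ffun 'I_n.+1 -> 'I_(2 * M).+1}) : {poly int} :=
  \poly_(i < n.+1) ((f (inord i))%:Z - M%:Z).
apply: (@sub_finite_set _ _ (\bigcup_(f in [set f | q f != 0]) [set x | root (map_poly intr (q f)) x])).
  move=> x [xint xk]; have [p [pm px pd]] := integral_conj_poly xint.
  have p0 := monic_neq0 pm.
  have sp : (size p <= n.+1)%N.
    have := dvdp_leq (monic_neq0 (char_poly_monic _)) pd.
    by rewrite size_char_poly size_rat_int_poly.
  have coefp i : `|p`_i| <= M%:Z.
    have pCE : map_poly ratr (pZtoQ p) = map_poly intr p :> {poly C}.
      by rewrite -map_poly_comp; apply: eq_map_poly => z; rewrite /= ratr_int.
    have [r pr] := closed_field_poly_normal (map_poly intr p : {poly C}).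
    have lp : lead_coef (map_poly intr p : {poly C}) = 1.
      by apply/eqP; rewrite -monicE monic_map.
    rewrite lp scale1r in pr.
    have sr : (size r <= n)%N.
      rewrite -ltnS -(size_prod_XsubC r id) -pr size_map_inj_poly ?rmorph0 //.
      exact: intr_inj.
    have hr z : z \in r -> `|z| <= k%:R.
      rewrite -root_prod_XsubC -pr -pCE => rz.
      have /root_embedding[s ->] // : root (map_poly ratr (char_poly (multmx x))) z.
      by apply: root_dvdp rz; rewrite dvdp_map.
    have := coef_prod_XsubC_bound i hr (ler0n _ _).
    rewrite -pr coef_map /= -intr_norm -[1]/(1%:R) -natrD -natrX => /le_trans h.
    rewrite -(ler_int C); apply: h; rewrite -[leRHS]/(M%:R) ler_nat.
    by apply: leq_pexp2l sr; rewrite addn_gt0.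
  have shift i : (absz (p`_i + M%:Z)%R < (2 * M).+1)%N.
    have := coefp i; rewrite ler_norml => /andP[h1 h2]; lia.
  pose f : {ffun 'I_n.+1 -> 'I_(2 * M).+1} := [ffun i => Ordinal (shift (val i))].
  have qp : q f = p.
    apply/polyP => i; rewrite coef_poly; case: ltnP => [ilt|ige]; last first.
      by rewrite nth_default // (leq_trans sp).
    rewrite ffunE /= inordK // gez0_abs ?addrK //.
    by rewrite -lerBlDr sub0r; have := coefp i; rewrite ler_norml => /andP[].
  by exists f; rewrite /= qp.
apply: bigcup_finite => [|f qf]; first exact: finite_finset.
apply: finite_roots; rewrite -in_alg_pZtoQ map_poly_eq0.
by rewrite -size_poly_eq0 size_rat_int_poly size_poly_eq0.
Qed.

End IntegralPolynomials.

(** * Totally positive exponents *)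

Section Exponents.
Variables (R : realType) (K : fieldExtType rat) (K_real : totally_real R K).
Local Notation O := (ring_of_integers K).
Local Notation H := (exponent R K).

Lemma complex_embedding_real (s : {rmorphism K -> R[i]}) :
  exists r : {rmorphism K -> R}, forall x, s x = Complex (r x) 0.
Proof.
have sE x : s x = Complex (complex.Re (s x)) 0.
  by have := K_real s x; case: (s x) => u v /= ->.
have [r hr] : exists r : {rmorphism K -> R}, r =1 (fun x => complex.Re (s x)).
  apply: exists_rmorphism => [x y|x y|]; last by rewrite rmorph1.
    by rewrite rmorphB; case: (s x) (s y) => [? ?] [].
  rewrite rmorphM (sE x) (sE y) /=; simpc => /=; by rewrite ?mulr0 ?subr0.
by exists r => x; rewrite sE hr.
Qed.

(** Keeps total positivity from being vacuous: through such an embedding it excludes 0 and gives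
    conicality. *)
Lemma exists_real_embedding : exists r : {rmorphism K -> R}, True.
Proof.
have [s _] := exists_embedding K (R[i]).
by have [r _] := complex_embedding_real s; exists r.
Qed.

Lemma totpos_neq0 (x : O) : totpos R x -> x != 0.
Proof.
have [r _] := exists_real_embedding; move=> /(_ r); apply: contraTneq => ->.
by rewrite rmorph0 ltxx.
Qed.

Lemma exponent_cases (a : H) : a = 0 \/ totpos R (a : O).
Proof.
case: a => a ha; have /asboolP[a0|] := ha; last by right.
by left; apply: val_inj.
Qed.

Lemma exponent_ge0 (r : {rmorphism K -> R}) (a : H) : 0 <= r (a : K).
Proof.
by have [->|/(_ r)/ltW//] := exponent_cases a; rewrite rmorph0.
Qed.

Lemma exponent_neq0 (a : H) : a != 0 <-> totpos R (a : O).
Proof.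
split=> [a0|/totpos_neq0]; first by have [a0'|//] := exponent_cases a; rewrite a0' eqxx in a0.
by apply: contraNneq => ->.
Qed.

Lemma totpos_exponent (x : O) : totpos R x -> exists a : H, (a : O) = x.
Proof.
move=> xp; have xh : x \in totpos0 R (K := K) by apply/asboolP; right.
by exists (Exponent xh).
Qed.

Lemma exponent_addI (a x y : H) : a + x = a + y -> x = y.
Proof. by move=> /(congr1 val); rewrite !raddfD => /addrI/val_inj. Qed.

Lemma exponent_conical (a b : H) : a + b = 0 -> a = 0.
Proof.
move=> ab; apply/eqP; apply: contraT => /exponent_neq0 ap.
have [r _] := exists_real_embedding.
have := congr1 (fun z : H => r (z : K)) ab; rewrite /= rmorphD rmorph0 => /eqP.
by rewrite gt_eqF // ltr_wpDr ?exponent_ge0 //; exact: ap.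
Qed.

(** All conjugates are roots of the same integer polynomial, so its Cauchy bound is uniform in the
    embedding. *)
Lemma integer_bound (x : O) : exists k : nat, forall r : {rmorphism K -> R}, r (x : K) <= k%:R.
Proof.
have /asboolP[p pm px] := valP x.
pose q : {poly R} := map_poly intr p.
have q0 : q != 0 by apply: monic_neq0; exact: monic_map.
exists (Num.bound (cauchy_bound q)) => r.
have qr : q.[r (x : K)] = 0.
  have -> : q = map_poly r (map_poly intr p).
    by rewrite -map_poly_comp; apply: eq_map_poly => z; rewrite /= rmorph_int.
  by rewrite horner_map /= (eqP px) rmorph0.
apply: (le_trans (ler_norm _)); apply: (le_trans (ltW (cauchy_boundP q0 qr))).
apply: ltW; apply: archi_boundP; apply: ltW.
exact: le_lt_trans (normr_ge0 _) (cauchy_boundP q0 qr).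
Qed.

(** If $a+b=d$, then $0\le r(a)\le r(d)$ for every real embedding $r$, so the conjugates of both
    summands are bounded. *)
Lemma exponent_dec_finite : dec_finite H.
Proof.
move=> d; have [k hk] := integer_bound (d : O).
pose bounded := [set x : K | integralOver (intr : int -> K) x /\
  forall s : {rmorphism K -> R[i]}, `|s x| <= k%:R].
have fin := finite_preimage (f := fun a : H => a : K) (fun a b _ _ ab => val_inj (val_inj ab))
  (bounded_integers_finite K (R[i]) k).
have {fin} : finite_set [set a : H | bounded a] by exact: fin.
move=> fin; apply: (@sub_finite_set _ _ ([set a : H | bounded a] `*` [set a : H | bounded a]));
  last exact: finite_setX.
have part (a b : H) : a + b = d -> bounded a.
  move=> abd; split; first by have /asboolP := valP (val a).
  move=> s; have [r ->] := complex_embedding_real s.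
  have ar : r (a : K) <= k%:R.
    apply: (le_trans _ (hk r)); rewrite -abd /= rmorphD lerDl; exact: exponent_ge0.
  have := exponent_ge0 r a; move: (r _) ar => y yk y0.
  have -> : k%:R = Complex k%:R 0 :> R[i] by rewrite -(rmorph_nat (real_complex R)).
  by rewrite -[Complex y 0]/(real_complex R y) normc_def /= lecE /= eqxx expr0n addr0 sqrtr_sqr ger0_norm.
by move=> [a b] /= abd; split; [exact: part abd|apply: (part b a); rewrite addrC].
Qed.

Lemma natmul_val (a : H) m : val (val (a *+ m)) = val (val a) *+ m.
Proof. by rewrite !raddfMn. Qed.

Lemma integer_natmulI m (x y : K) : (0 < m)%N -> x *+ m = y *+ m -> x = y.
Proof.
move=> m0 xy; have [r _] := exists_real_embedding.
apply: (fmorph_inj r); have := congr1 r xy; rewrite !rmorphMn /=.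
by apply: pmulrnI.
Qed.

Lemma primitive_neq0 (a : H) : primitive R (a : O) -> a != 0.
Proof. by move=> [/exponent_neq0]. Qed.

(** The largest $n$ with $d\in nH$ has a primitive quotient. *)
Lemma primitive_exists (d : H) : d != 0 ->
  exists (a : H) n, [/\ primitive R (a : O), (0 < n)%N & d = a *+ n].
Proof.
move=> d0; have [N hN] := natmul_parts_bounded exponent_dec_finite exponent_addI exponent_conical d.
pose P n := `[< exists a : H, d = a *+ n >].
have exP : exists n, P n by exists 1%N; apply/asboolP; exists d.
have bP n : P n -> (n <= N)%N.
  move=> /asboolP[a da]; apply: (hN a); last by rewrite -da; apply: parts_self; exact: exponent_dec_finite.
  by apply: contraNneq d0 => a0; rewrite da a0 mul0rn.
case: (ex_maxnP exP bP) => n /asboolP[a da] nmax.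
have n0 : (0 < n)%N by case: (n) da d0 => // ->; rewrite mulr0n eqxx.
exists a, n; split=> //; split.
  by apply/exponent_neq0; apply: contraNneq d0 => a0; rewrite da a0 mul0rn.
move=> m m2 [y /totpos_exponent[z <-] az].
have az' : a = z *+ m by apply: val_inj; rewrite raddfMn.
have : P (m * n)%N by apply/asboolP; exists z; rewrite mulrnA -az'.
by move=> /nmax; nia.
Qed.

Lemma primitive_coprime (a b : H) m n : primitive R (b : O) -> (0 < m)%N -> coprime m n ->
  a *+ m = b *+ n -> m = 1%N.
Proof.
move=> [bp bprim] m0 /eqP mn ab; apply/eqP; rewrite eqn_leq m0 andbT leqNgt.
apply/negP => m2.
have [u v uv _] := egcdnP n m0; rewrite mn in uv.
(* From $um=vn+1$ and $am=bn$ one gets $zm=b$. As a difference, [z] is a priori only in $\mathcal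
   O$; its total positivity follows from that of [b]. *)
pose z : O := (b : O) *+ u - (a : O) *+ v.
have zb : (b : O) = z *+ m.
  have abO : (a : O) *+ m = (b : O) *+ n by have := congr1 val ab; rewrite !raddfMn.
  rewrite /z mulrnBl -!mulrnA uv [(v * m)%N]mulnC mulrnA abO -mulrnA [(n * v)%N]mulnC.
  by rewrite mulrnDr mulr1n addrAC subrr add0r.
apply: (bprim m m2); exists z => // r.
have bK : (b : K) = (z : K) *+ m.
  by transitivity (integer_val (z *+ m)); [rewrite -zb|exact: (raddfMn (val : O -> K))].
by have := bp r; rewrite /= bK rmorphMn /= pmulrn_lgt0.
Qed.

Lemma primitive_unique (a b : H) m n : primitive R (a : O) -> primitive R (b : O) ->
  (0 < m)%N -> (0 < n)%N -> a *+ m = b *+ n -> a = b /\ m = n.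
Proof.
move=> pa pb m0 n0 ab.
pose g := gcdn m n; have g0 : (0 < g)%N by rewrite gcdn_gt0 m0.
have mE : m = (m %/ g * g)%N by rewrite divnK ?dvdn_gcdl.
have nE : n = (n %/ g * g)%N by rewrite divnK ?dvdn_gcdr.
have m'0 : (0 < m %/ g)%N by rewrite divn_gt0 // dvdn_leq ?dvdn_gcdl.
have n'0 : (0 < n %/ g)%N by rewrite divn_gt0 // dvdn_leq ?dvdn_gcdr.
have co : coprime (m %/ g) (n %/ g).
  by rewrite /coprime -(eqn_pmul2r g0) mul1n muln_gcdl -mE -nE.
have ab' : a *+ (m %/ g) = b *+ (n %/ g).
  do 2 apply: val_inj; apply: (integer_natmulI g0); rewrite !natmul_val.
  by rewrite -!mulrnA -mE -nE -!natmul_val ab.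
have m1 := primitive_coprime pb m'0 co ab'.
have n1 : (n %/ g = 1)%N.
  by apply: (primitive_coprime pa n'0 _ (esym ab')); rewrite coprime_sym.
by move: ab'; rewrite m1 n1 !mulr1n => ->; rewrite mE nE m1 n1.
Qed.

End Exponents.

(** * Residue classes modulo 5 and the product identities *)

Lemma residue_morphism (A : comNzRingType) (p : prime_idealr A) (n : nat)
  (f : {rmorphism {ideal_quot p} -> 'Z_n}) : bijective f ->
  exists c : {rmorphism A -> 'Z_n}, forall x y, (x - y \in (p : {pred A})) = (c x == c y).
Proof.
move=> /bij_inj finj; exists (f \o \pi_({ideal_quot p})%qT : {rmorphism A -> 'Z_n}) => x y.
by rewrite Quotient.idealrBE /= (inj_eq finj).
Qed.

(** The classes 1, 4 are the nonzero squares modulo 5 and 2, 3 the non-squares, so this is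
    multiplicativity of the quadratic character. *)
Lemma Z5_mulr_classes (r : 'Z_5) (m : nat) :
  ((r *+ m \in [:: 1; 4%:R]) =
    (r \in [:: 1; 4%:R]) && ((m %% 5)%N \in [:: 1; 4]%N) ||
    (r \in [:: 2%:R; 3%:R]) && ((m %% 5)%N \in [:: 2; 3]%N)) /\
  ((r *+ m \in [:: 2%:R; 3%:R]) =
    (r \in [:: 1; 4%:R]) && ((m %% 5)%N \in [:: 2; 3]%N) ||
    (r \in [:: 2%:R; 3%:R]) && ((m %% 5)%N \in [:: 1; 4]%N)).
Proof.
have -> : r *+ m = r *+ (m %% 5).
  by rewrite -[in LHS]mulr_natr -[in RHS]mulr_natr Zp_nat_mod.
have : (m %% 5 < 5)%N by rewrite ltn_mod.
by case: r => [[|[|[|[|[|r]]]]] hr] //; case: (m %% 5)%N => [|[|[|[|[|k]]]]].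
Qed.

Theorem corollary3p12 (R : realType) (K : fieldExtType rat)
    (K_real : totally_real R K)
    (p : prime_idealr (ring_of_integers K))
    (p5 : (5%:R : ring_of_integers K) \in (p : {pred ring_of_integers K}))
    (quot_p : exists f : {rmorphism {ideal_quot p} -> 'Z_5}, bijective f) :
  let H := exponent R K in
  let X : set H := [set g : H | primitive R (g : ring_of_integers K) /\
                                eqmod_or p 1 4 (g : ring_of_integers K)] in
  let Y : set H := [set g : H | primitive R (g : ring_of_integers K) /\
                                eqmod_or p 2 3 (g : ring_of_integers K)] in
  let P14 : qsum R H :=
    qprod [set d : H | totpos R (d : ring_of_integers K) /\
                       eqmod_or p 1 4 (d : ring_of_integers K)] (@qgeom R H) in
  let P23 : qsum R H :=
    qprod [set d : H | totpos R (d : ring_of_integers K) /\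
                       eqmod_or p 2 3 (d : ring_of_integers K)] (@qgeom R H) in
  [/\ P14 = qmul (qprod X (@RR_prod R H 1 4)) (qprod Y (@RR_prod R H 2 3)),
      qmul (qprod X (@RR_prod R H 1 4)) (qprod Y (@RR_prod R H 2 3)) =
        qmul (qprod X (@RR1_sum R H)) (qprod Y (@RR2_sum R H)),
      P23 = qmul (qprod X (@RR_prod R H 2 3)) (qprod Y (@RR_prod R H 1 4)) &
      qmul (qprod X (@RR_prod R H 2 3)) (qprod Y (@RR_prod R H 1 4)) =
        qmul (qprod X (@RR2_sum R H)) (qprod Y (@RR1_sum R H))].
Proof.
move=> H X Y P14 P23.
have [f /residue_morphism[c hc]] := quot_p.
(* Congruences modulo the prime become equalities in $\mathbb Z/5$, where [Z5_mulr_classes]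
   applies. *)
have eqE a b (x : ring_of_integers K) : eqmod_or p a b x <-> c x \in [:: a%:R; b%:R].
  by rewrite /eqmod_or !hc !rmorph_nat !inE; split=> [[]->|/orP[]]; rewrite ?orbT; auto.
have fin : dec_finite H := exponent_dec_finite K_real.
have addI : forall a x y : H, a + x = a + y -> x = y := @exponent_addI R K.
have conical : forall a b : H, a + b = 0 -> a = 0 := @exponent_conical R K K_real.
have primX (a : H) : X a -> a != 0 by move=> [/(primitive_neq0 K_real)].
have primY (a : H) : Y a -> a != 0 by move=> [/(primitive_neq0 K_real)].
have XY : X `&` Y `<=` set0.
  move=> a [[_ /eqE h14] [_ /eqE h23]]; move: h14 h23; rewrite !inE.
  by move=> /orP[]/eqP->.
have cMn (a : H) m : c ((a *+ m : H) : ring_of_integers K) = c (a : ring_of_integers K) *+ m.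
  by rewrite -rmorphMn; congr (c _); exact: (raddfMn (val : H -> ring_of_integers K)).
have tp (a : H) m : primitive R (a : ring_of_integers K) -> (0 < m)%N ->
    totpos R ((a *+ m : H) : ring_of_integers K).
  move=> /(primitive_neq0 K_real) a0 m0; apply/exponent_neq0 => //.
  exact: natmul_neq0.
have dissect := @qprod_dissect R H fin addI conical
  [set g : H | primitive R (g : ring_of_integers K)] (primitive_neq0 K_real)
  (primitive_exists K_real) (@primitive_unique R K K_real).
have Xp : X `<=` [set g : H | primitive R (g : ring_of_integers K)] by move=> a [].
have Yp : Y `<=` [set g : H | primitive R (g : ring_of_integers K)] by move=> a [].
have D0 i j (d : H) : totpos R (d : ring_of_integers K) /\ eqmod_or p i j (d : ring_of_integers K) ->
    d != 0.
  by move=> [/(exponent_neq0 K_real)].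
split.
- apply: (dissect _ X Y) => // [d /D0 //|a m pa m0].
  have [h _] := Z5_mulr_classes (c (a : ring_of_integers K)) m.
  split=> [[_ /eqE]|]; last first.
    move=> h'; split; first exact: tp.
    apply/eqE; rewrite cMn h.
    by case: h' => -[[_ /eqE ->] ->]; rewrite ?orbT.
  by rewrite cMn h => /orP[]/andP[ca ->]; [left|right]; split=> //; split=> //; apply/eqE.
- congr qmul; apply: (@eq_qprod R H fin) => a /=.
    by move=> /primX a0; rewrite (rogers_ramanujan1 R fin addI conical).
  by move=> /primY a0; rewrite (rogers_ramanujan2 R fin addI conical).
- apply: (dissect _ X Y) => // [d /D0 //|a m pa m0].
  have [_ h] := Z5_mulr_classes (c (a : ring_of_integers K)) m.
  split=> [[_ /eqE]|]; last first.
    move=> h'; split; first exact: tp.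
    apply/eqE; rewrite cMn h.
    by case: h' => -[[_ /eqE ->] ->]; rewrite ?orbT.
  by rewrite cMn h => /orP[]/andP[ca ->]; [left|right]; split=> //; split=> //; apply/eqE.
congr qmul; apply: (@eq_qprod R H fin) => a /=.
  by move=> /primX a0; rewrite (rogers_ramanujan2 R fin addI conical).
by move=> /primY a0; rewrite (rogers_ramanujan1 R fin addI conical).
Qed.
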